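(* Let $f\colon\mathfrak g\twoheadrightarrow\mathfrak h$ be a surjective map of pronilpotent dglas, let $\xi_0\in\mathrm{MC}(\mathfrak h)$ and let $\xi\in\mathrm{MC}(\mathfrak g)$ with $f(\xi)=\xi_0$. Let $\mathfrak k^\xi$ be the kernel of $f$ with the twisted differential $d^\xi=d+\mathrm{ad}(\xi)$. Then $\exp(H^0(\mathfrak h^{\xi_0}))$ acts on $\mathscr{MC}(\mathfrak k^\xi)$, and $\mathscr{MC}(\mathfrak k^\xi)/\exp(H^0(\mathfrak h^{\xi_0}))$ is isomorphic (as a set) to the fibre in $\mathscr{MC}(\mathfrak g)$ over the class of $\xi_0$ in $\mathscr{MC}(\mathfrak h)$.
   Context: The ground field has characteristic zero. A pronilpotent dgla is an inverse limit of nilpotent differential graded Lie algebras; maps are compatible with the inverse limit topologies. $\mathrm{MC}(\mathfrak g)$ is the set of degree one (odd) $\xi\in\mathfrak g$ with $d\xi+\frac12[\xi,\xi]=0$. For $\xi\in\mathrm{MC}(\mathfrak g)$, $\mathfrak g^\xi$ is the graded Lie algebra $\mathfrak g$ with differential $d^\xi=d+\mathrm{ad}(\xi)$; similarly $\mathfrak h^{\xi_0}$. For a pronilpotent Lie algebra $\mathfrak a$, $\exp(\mathfrak a)=\{e^x:x\in\mathfrak a\}$ is the group with Baker–Campbell–Hausdorff product. The gauge action of $\exp(\mathfrak g^0)$ on $\mathrm{MC}(\mathfrak g)$ is $e^y\cdot\xi=\xi+\sum_{n\ge1}\frac1{n!}(\mathrm{ad}\,y)^{n-1}([y,\xi]-dy)$,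 and $\mathscr{MC}(\mathfrak g)$ denotes the set of gauge equivalence classes of $\mathrm{MC}(\mathfrak g)$ (equivalently, of classes for the relation generated by Sullivan homotopy, i.e. by Maurer–Cartan elements of $\mathfrak g[z,dz]$ evaluated at $z=0,1$). The map $\eta\mapsto\eta+\xi$ identifies $\mathrm{MC}(\mathfrak k^\xi)$ with the fibre of $\mathrm{MC}(\mathfrak g)\to\mathrm{MC}(\mathfrak h)$ over $\xi_0$. The action referred to is $e^{y_0}\star\eta=e^y\cdot(\eta+\xi)-\xi$ for a $d^{\xi_0}$-cycle $y_0\in\mathfrak h^0$ and any $y\in\mathfrak g^0$ with $f(y)=y_0$, on classes of $\eta\in\mathrm{MC}(\mathfrak k^\xi)$. *)

(* Defs.v *)
From HB Require Import structures.
From mathcomp Require Import all_boot all_order all_algebra ssrAC.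
From mathcomp Require Import monoid.
From mathcomp Require Import boolp classical_sets.

Set Implicit Arguments.
Unset Strict Implicit.
Unset Printing Implicit Defensive.

Import GRing.Theory.
Local Open Scope ring_scope.

(* Z-graded, cohomological.  To avoid transports along equalities between
   degrees, an operation landing in degree i + j is indexed by a target degree
   k together with a proof of i + j = k (the type of such proofs has at most
   one inhabitant, so the proof carries no data). *)
Record dgla (F : fieldType) : Type := Dgla {
  gr :> int -> lmodType F;
  br : forall i j k : int, i + j = k -> gr i -> gr j -> gr k;
  df : forall i j : int, i + 1 = j -> gr i -> gr j;
  br_linl : forall i j k (p : i + j = k) y, linear (br p ^~ y);
  br_linr : forall i j k (p : i + j = k) x, linear (br p x);
  df_lin : forall i j (p : i + 1 = j), linear (df p);
  br_anti : forall i j k (p : i + j = k) (q : j + i = k) x y,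
    br p x y = - ((-1) ^ (i * j) *: br q y x);
  br_jacobi : forall i j k ij jk ik n (pij : i + j = ij) (pjk : j + k = jk)
      (pik : i + k = ik) (p : i + jk = n) (q : ij + k = n) (r : j + ik = n)
      x y z,
    br p x (br pjk y z) = br q (br pij x y) z
                          + (-1) ^ (i * j) *: br r y (br pik x z);
  df_leibniz : forall i j k i' j' k' (p : i + j = k) (pi : i + 1 = i')
      (pj : j + 1 = j') (pk : k + 1 = k') (q : i' + j = k') (r : i + j' = k')
      x y,
    df pk (br p x y) = br q (df pi x) y + (-1) ^ i *: br r x (df pj y);
  df_df : forall i j k (p : i + 1 = j) (q : j + 1 = k) x, df q (df p x) = 0
}.

Record dgmap (F : fieldType) (L M : dgla F) : Type := DgMap {
  mf :> forall n, L n -> M n;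
  mf_lin : forall n, linear (@mf n);
  mf_br : forall i j k (p : i + j = k) x y,
    mf (br p x y) = br p (mf x) (mf y);
  mf_df : forall i j (p : i + 1 = j) x, mf (df p x) = df p (mf x)
}.
Arguments mf {F L M} _ n _.

(* The lower central series: [lcs L n] is the graded subspace of L spanned by
   the brackets of n + 1 elements. *)
Inductive lcs (F : fieldType) (L : dgla F) : nat -> forall i, L i -> Prop :=
| Lcs0 i (x : L i) : lcs 0 x
| LcsBr n i j k (p : i + j = k) (x : L i) (y : L j) :
    lcs n y -> lcs n.+1 (br p x y)
| LcsLin n i a (x y : L i) : lcs n x -> lcs n y -> lcs n (a *: x + y).

Definition nilpotent (F : fieldType) (L : dgla F) : Prop :=
  exists n, forall i (x : L i), lcs n x -> x = 0.

Record invsys (F : fieldType) : Type := InvSys {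
  idx : Type;
  ile : idx -> idx -> Prop;
  ile_refl : forall i, ile i i;
  ile_trans : forall i j k, ile i j -> ile j k -> ile i k;
  ile_directed : forall i j, exists k, ile i k /\ ile j k;
  idx_inhabited : inhabited idx;
  obj :> idx -> dgla F;
  obj_nilpotent : forall i, nilpotent (obj i);
  tr : forall i j, ile i j -> dgmap (obj j) (obj i);
  tr_id : forall i (p : ile i i) n (x : obj i n), tr p n x = x;
  tr_comp : forall i j k (p : ile i j) (q : ile j k) (r : ile i k) n
    (x : obj k n), tr p n (tr q n x) = tr r n x
}.

(* A dgla presented as the inverse limit of an inverse system of nilpotent
   dglas: in each degree the projections identify it with the space of
   compatible families. *)
Record pronil (F : fieldType) : Type := Pronil {
  plim :> dgla F;
  psys : invsys F;
  pr : forall i : idx psys, dgmap plim (psys i);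
  pr_compat : forall i j (p : ile i j) n (x : plim n),
    tr p n (pr j n x) = pr i n x;
  pr_limit : forall n (t : forall i, psys i n),
    (forall i j (p : ile i j), tr p n (t j) = t i) ->
    exists! x : plim n, forall i, pr i n x = t i
}.

(* The inverse limit topology (discrete components) has the kernels of the
   projections as a basis of neighbourhoods of 0. *)
Record pdgmap (F : fieldType) (g h : pronil F) : Type := PMap {
  pmf :> dgmap g h;
  pmf_cont : forall n (j : idx (psys h)), exists i : idx (psys g),
    forall x : g n, pr i n x = 0 -> pr j n (pmf n x) = 0
}.

Definition psurjective (F : fieldType) (g h : pronil F) (f : pdgmap g h) : Prop :=
  forall n (y : h n), exists x : g n, f n x = y.

(* Sums of series for the inverse limit topology: the partial sums are
   eventually equal to s in each component.  Such an s is unique. *)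
Definition is_psum (F : fieldType) (g : pronil F) n (t : nat -> g n) (s : g n) :
    Prop :=
  forall i, exists N, forall m, (N <= m)%N ->
    pr i n (\sum_(k < m) t k) = pr i n s.

Definition psum (F : fieldType) (g : pronil F) n (t : nat -> g n) : g n :=
  xget 0 [set s | is_psum t s].

(* The quotient set T/R; only used when R is an equivalence relation. *)
Definition classes (T : Type) (R : T -> T -> Prop) : Type :=
  {C : set T | exists x, C = R x}.

Definition cls (T : Type) (R : T -> T -> Prop) (x : T) : classes R :=
  exist _ (R x : set T) (ex_intro _ x erefl).

(* The map induced on classes; it does not depend on the representatives when
   f preserves the relations. *)
Definition classes_map (T U : Type) (R : T -> T -> Prop) (S : U -> U -> Prop)
    (f : T -> U) (C : classes R) : classes S :=
  cls S (f (sval (cid (svalP C)))).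

Definition mc_curv (F : fieldType) (L : dgla F) (x : L 1) : L 2 :=
  df (erefl : 1 + 1 = 2 :> int) x
  + 2^-1 *: br (erefl : 1 + 1 = 2 :> int) x x.

Definition MC (F : fieldType) (L : dgla F) : Type :=
  {x : L 1 | mc_curv x == 0}.

Lemma mf_D (F : fieldType) (L M : dgla F) (f : dgmap L M) n (x y : L n) :
  f n (x + y) = f n x + f n y.
Proof. by have := mf_lin f 1 x y; rewrite !scale1r. Qed.

Lemma mf_0 (F : fieldType) (L M : dgla F) (f : dgmap L M) n : f n 0 = 0.
Proof. by apply: (addrI (f n 0)); rewrite -mf_D !addr0. Qed.

Lemma mf_Z (F : fieldType) (L M : dgla F) (f : dgmap L M) n a (x : L n) :
  f n (a *: x) = a *: f n x.
Proof. by have := mf_lin f a x 0; rewrite mf_0 !addr0. Qed.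

Lemma mc_map_subproof (F : fieldType) (L M : dgla F) (f : dgmap L M)
  (x : MC L) : mc_curv (f 1 (val x)) == 0.
Proof.
have := eqP (valP x); rewrite /mc_curv => mcE.
by rewrite -mf_df -mf_br -mf_Z -mf_D mcE mf_0.
Qed.

Definition mc_map (F : fieldType) (L M : dgla F) (f : dgmap L M) (x : MC L) :
  MC M := exist _ (f 1 (val x)) (mc_map_subproof f x).

Lemma idem0 (V : zmodType) (u : V) : u = u + u -> u = 0.
Proof. by move/eqP; rewrite -{1}[u]addr0 (inj_eq (addrI u)) => /eqP. Qed.

Section Operations.
Variables (F : fieldType) (L : dgla F).

Lemma br0l i j k (p : i + j = k) (y : L j) : br p (0 : L i) y = 0.
Proof.
by have := br_linl p y 1 0 0; rewrite !scale1r addr0 => /idem0.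
Qed.

Lemma br0r i j k (p : i + j = k) (x : L i) : br p x (0 : L j) = 0.
Proof.
by have := br_linr p x 1 0 0; rewrite !scale1r addr0 => /idem0.
Qed.

Lemma df0 i j (p : i + 1 = j) : df p (0 : L i) = 0.
Proof.
by have := df_lin p 1 (0 : L i) 0; rewrite !scale1r addr0 => /idem0.
Qed.

Lemma brDl i j k (p : i + j = k) (x x' : L i) (y : L j) :
  br p (x + x') y = br p x y + br p x' y.
Proof. by have := br_linl p y 1 x x'; rewrite !scale1r. Qed.

Lemma brDr i j k (p : i + j = k) (x : L i) (y y' : L j) :
  br p x (y + y') = br p x y + br p x y'.
Proof. by have := br_linr p x 1 y y'; rewrite !scale1r. Qed.

Lemma brZl i j k (p : i + j = k) a (x : L i) (y : L j) :
  br p (a *: x) y = a *: br p x y.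
Proof. by have := br_linl p y a x 0; rewrite br0l !addr0. Qed.

Lemma brZr i j k (p : i + j = k) a (x : L i) (y : L j) :
  br p x (a *: y) = a *: br p x y.
Proof. by have := br_linr p x a y 0; rewrite br0r !addr0. Qed.

Lemma dfD i j (p : i + 1 = j) (x y : L i) : df p (x + y) = df p x + df p y.
Proof. by have := df_lin p 1 x y; rewrite !scale1r. Qed.

Lemma dfZ i j (p : i + 1 = j) a (x : L i) : df p (a *: x) = a *: df p x.
Proof. by have := df_lin p a x 0; rewrite df0 !addr0. Qed.

Lemma br_irr i j k (p q : i + j = k) (x : L i) (y : L j) : br p x y = br q x y.
Proof. by rewrite (eq_irrelevance p q). Qed.

End Operations.

Lemma deg_swap (i j k : int) : i + j = k -> j + i = k.
Proof. by rewrite addrC. Qed.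

Section Twist.
Variables (F : fieldType) (charF0 : [pchar F] =i pred0) (L : dgla F).
Variable xi : MC L.

Definition twist_df i j (p : i + 1 = j) (x : L i) : L j :=
  df p x + br (deg_swap p) (val xi) x.

Lemma two_unit : (2 : F) != 0.
Proof. by have := charF0 2; rewrite !inE /= => ->. Qed.

Lemma twist_lin i j (p : i + 1 = j) : linear (twist_df p).
Proof.
by move=> a x y; rewrite /twist_df df_lin br_linr scalerDr addrACA.
Qed.

Lemma twist_leibniz i j k i' j' k' (p : i + j = k) (pi : i + 1 = i')
    (pj : j + 1 = j') (pk : k + 1 = k') (q : i' + j = k') (r : i + j' = k')
    (x : L i) (y : L j) :
  twist_df pk (br p x y) =
    br q (twist_df pi x) y + (-1) ^ i *: br r x (twist_df pj y).
Proof.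
rewrite /twist_df (df_leibniz _ pi pj _ q r) brDl brDr scalerDr.
rewrite (br_jacobi (deg_swap pi) p (deg_swap pj) _ q r) mul1r.
by rewrite addrACA.
Qed.

Lemma twist_df_df i j k (p : i + 1 = j) (q : j + 1 = k) (x : L i) :
  twist_df q (twist_df p x) = 0.
Proof.
have e2 : 2 + i = k by rewrite -q -p (addrC 2) -addrA.
have := eqP (valP xi); rewrite /mc_curv => mcE.
rewrite /twist_df dfD df_df add0r brDr.
rewrite (df_leibniz _ (erefl : 1 + 1 = 2 :> int) p _ e2 (deg_swap q)).
rewrite expr1z scaleN1r.
have -> : br (deg_swap q) (val xi) (br (deg_swap p) (val xi) x) =
    2^-1 *: br e2 (br (erefl : 1 + 1 = 2 :> int) (val xi) (val xi)) x.
  apply: (scalerI two_unit); rewrite scalerA mulfV ?two_unit // scale1r.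
  rewrite scaler_nat mulr2n.
  rewrite {1}(br_jacobi (erefl : 1 + 1 = 2 :> int) (deg_swap p) (deg_swap p)
    _ e2 (deg_swap q)).
  by rewrite mul1r expr1z scaleN1r subrK.
by rewrite addrA subrK -brZl -brDl mcE br0l.
Qed.

Definition twist : dgla F :=
  @Dgla F (gr L) (@br F L) twist_df (@br_linl F L) (@br_linr F L) twist_lin
    (@br_anti F L) (@br_jacobi F L) twist_leibniz twist_df_df.

Lemma twist_lcs n i (x : L i) : @lcs F twist n i x -> @lcs F L n i x.
Proof.
move=> H; induction H as [i x|n i j k p x y _ IH|n i a x y _ IHx _ IHy].
- exact: Lcs0.
- exact: (@LcsBr F L).
- exact: (@LcsLin F L).
Qed.

Lemma twist_nilpotent : nilpotent L -> nilpotent twist.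
Proof. by case=> n Ln; exists n => i x /twist_lcs; exact: Ln. Qed.

Lemma mc_shift_subproof (eta : MC twist) :
  mc_curv ((val eta : L 1) + val xi) == 0.
Proof.
pose e := erefl : 1 + 1 = 2 :> int.
set y : L 1 := val eta; set x : L 1 := val xi.
have Ey : df e y + br e x y + 2^-1 *: br e y y = 0.
  rewrite (br_irr e (deg_swap e) x y); exact: (eqP (valP eta)).
have Ex : df e x + 2^-1 *: br e x x = 0 by exact: (eqP (valP xi)).
have bC : br e y x = br e x y.
  by rewrite (br_anti _ e) mul1r expr1z scaleN1r opprK.
have half : 2^-1 *: br e x y + 2^-1 *: br e x y = br e x y.
  by rewrite -mulr2n -scaler_nat scalerA mulfV ?two_unit // scale1r.
rewrite /mc_curv -/e dfD !brDl !brDr bC !scalerDr; apply/eqP.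
rewrite [LHS](AC (2*(2*2)) ((1*(4*5)*3)*(2*6))) /=.
by rewrite half Ey Ex addr0.
Qed.

(* eta |-> eta + xi, from MC(L^xi) to MC(L) *)
Definition mc_shift (eta : MC twist) : MC L :=
  exist _ ((val eta : L 1) + val xi) (mc_shift_subproof eta).

End Twist.

Section TwistMap.
Variables (F : fieldType) (charF0 : [pchar F] =i pred0) (L M : dgla F).
Variables (f : dgmap L M) (xi : MC L) (xi0 : MC M).
Hypothesis fxi : f 1 (val xi) = val xi0.

Lemma twist_mf_df i j (p : i + 1 = j) (x : twist charF0 xi i) :
  f j (df p x) = df (d := twist charF0 xi0) p (f i x).
Proof. by rewrite /= /twist_df mf_D mf_df mf_br fxi. Qed.

(* f itself, as a map L^xi -> M^xi0 *)
Definition twist_map : dgmap (twist charF0 xi) (twist charF0 xi0) :=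
  @DgMap F (twist charF0 xi) (twist charF0 xi0) (mf f) (@mf_lin F L M f)
    (@mf_br F L M f) twist_mf_df.

End TwistMap.

Section TwistPronil.
Variables (F : fieldType) (charF0 : [pchar F] =i pred0) (g : pronil F).
Variable xi : MC g.

Let S := psys g.
Let xi_ (i : idx S) : MC (S i) := mc_map (pr i) xi.

Lemma twist_tr_subproof i j (p : ile i j) :
  tr p 1 (val (xi_ j)) = val (xi_ i).
Proof. exact: pr_compat. Qed.

Definition twist_sys : invsys F :=
  @InvSys F (idx S) (@ile F S) (@ile_refl F S) (@ile_trans F S)
    (@ile_directed F S) (idx_inhabited S)
    (fun i => twist charF0 (xi_ i))
    (fun i => twist_nilpotent charF0 (xi_ i) (obj_nilpotent i))
    (fun i j p => twist_map charF0 (twist_tr_subproof p))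
    (@tr_id F S) (@tr_comp F S).

(* g^xi, the inverse limit of the twists of the components of g by the
   components of xi *)
Definition ptwist : pronil F :=
  @Pronil F (twist charF0 xi) twist_sys
    (fun i => @twist_map F charF0 g (S i) (pr i) xi (xi_ i) erefl)
    (@pr_compat F g) (@pr_limit F g).

End TwistPronil.

Definition twist_pdgmap (F : fieldType) (charF0 : [pchar F] =i pred0)
    (g h : pronil F) (f : pdgmap g h) (xi : MC g) (xi0 : MC h)
    (fxi : f 1 (val xi) = val xi0) :
    pdgmap (ptwist charF0 xi) (ptwist charF0 xi0) :=
  @PMap F (ptwist charF0 xi) (ptwist charF0 xi0)
    (twist_map charF0 fxi) (@pmf_cont F g h f).

Definition submod_of (F : fieldType) (V : lmodType F) (S : submodClosed V) :=
  {x : V | x \in S}.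

HB.instance Definition _ (F : fieldType) (V : lmodType F)
  (S : submodClosed V) := [isSub of submod_of S for @sval _ _].
HB.instance Definition _ (F : fieldType) (V : lmodType F)
  (S : submodClosed V) := [Choice of submod_of S by <:].
HB.instance Definition _ (F : fieldType) (V : lmodType F)
  (S : submodClosed V) := [SubChoice_isSubLmodule of submod_of S by <:].

Section SubDgla.
Variables (F : fieldType) (L : dgla F) (S : forall n, submodClosed (L n)).
Hypothesis S_br : forall i j k (p : i + j = k) x y,
  x \in S i -> y \in S j -> br p x y \in S k.
Hypothesis S_df : forall i j (p : i + 1 = j) x, x \in S i -> df p x \in S j.

Definition sub_gr n : lmodType F := submod_of (S n).

Definition sub_br i j k (p : i + j = k) (x : sub_gr i) (y : sub_gr j) :
  sub_gr k := exist _ (br p (sval x) (sval y)) (S_br p (valP x) (valP y)).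

Definition sub_df i j (p : i + 1 = j) (x : sub_gr i) : sub_gr j :=
  exist _ (df p (sval x)) (S_df p (valP x)).

Definition sub_val n (x : sub_gr n) : L n := sval x.

Lemma sub_valP n : linear (@sub_val n).
Proof. by move=> a x y; exact: (linearP (\val : submod_of (S n) -> L n)). Qed.
HB.instance Definition _ n :=
  GRing.isLinear.Build F (sub_gr n) (L n) *:%R (@sub_val n) (@sub_valP n).

Lemma sub_val_inj n : injective (@sub_val n).
Proof. exact: val_inj. Qed.

Lemma sub_linl i j k (p : i + j = k) (y : sub_gr j) :
  linear (fun x : sub_gr i => sub_br p x y).
Proof. by move=> a x x'; apply: sub_val_inj; rewrite linearP [LHS]/sub_val /= ?[sval (_ + _)](sub_valP) br_linl. Qed.

Lemma sub_linr i j k (p : i + j = k) (x : sub_gr i) : linear (sub_br p x).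
Proof. by move=> a y y'; apply: sub_val_inj; rewrite linearP [LHS]/sub_val /= ?[sval (_ + _)](sub_valP) br_linr. Qed.

Lemma sub_df_lin i j (p : i + 1 = j) : linear (sub_df p).
Proof. by move=> a y y'; apply: sub_val_inj; rewrite linearP [LHS]/sub_val /= ?[sval (_ + _)](sub_valP) df_lin. Qed.

Lemma sub_anti i j k (p : i + j = k) (q : j + i = k)
    (x : sub_gr i) (y : sub_gr j) :
  sub_br p x y = - ((-1) ^ (i * j) *: sub_br q y x).
Proof.
by apply: sub_val_inj; rewrite linearN linearZ /= scalerN; exact: br_anti.
Qed.

Lemma sub_jacobi i j k ij jk ik n (pij : i + j = ij) (pjk : j + k = jk)
    (pik : i + k = ik) (p : i + jk = n) (q : ij + k = n) (r : j + ik = n)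
    (x : sub_gr i) (y : sub_gr j) (z : sub_gr k) :
  sub_br p x (sub_br pjk y z) = sub_br q (sub_br pij x y) z
                      + (-1) ^ (i * j) *: sub_br r y (sub_br pik x z).
Proof.
by apply: sub_val_inj; rewrite linearD linearZ /=; exact: br_jacobi.
Qed.

Lemma sub_leibniz i j k i' j' k' (p : i + j = k) (pi : i + 1 = i')
    (pj : j + 1 = j') (pk : k + 1 = k') (q : i' + j = k') (r : i + j' = k')
    (x : sub_gr i) (y : sub_gr j) :
  sub_df pk (sub_br p x y) =
    sub_br q (sub_df pi x) y + (-1) ^ i *: sub_br r x (sub_df pj y).
Proof.
by apply: sub_val_inj; rewrite linearD linearZ /=; exact: df_leibniz.
Qed.

Lemma sub_df_df i j k (p : i + 1 = j) (q : j + 1 = k) (x : sub_gr i) :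
  sub_df q (sub_df p x) = 0.
Proof. by apply: sub_val_inj; rewrite linear0 /= df_df. Qed.

Definition subdg : dgla F :=
  @Dgla F sub_gr sub_br sub_df sub_linl sub_linr sub_df_lin sub_anti
    sub_jacobi sub_leibniz sub_df_df.

Definition sub_incl : dgmap subdg L :=
  @DgMap F subdg L sub_val sub_valP
    (fun i j k p x y => erefl) (fun i j p x => erefl).

Lemma sub_nilpotent : nilpotent L -> nilpotent subdg.
Proof.
have sub_lcs n i (x : subdg i) : lcs n x -> lcs n (sub_incl i x).
  move=> H; induction H as [i x|n i j k p x y _ IH|n i a x y _ IHx _ IHy].
  - exact: Lcs0.
  - exact: LcsBr.
  - by rewrite mf_lin; exact: LcsLin.
by case=> n Ln; exists n => i x /sub_lcs/Ln x0; exact: val_inj.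
Qed.

End SubDgla.

Section Kernel.
Variables (F : fieldType) (g h : pronil F) (f : pdgmap g h).

Definition ker_pred n : {pred g n} := fun x => f n x == 0.

Lemma ker_closed n : submod_closed (@ker_pred n).
Proof.
split=> [|a x y]; rewrite !unfold_in /ker_pred ?mf_0 // => /eqP x0 /eqP y0.
by rewrite mf_lin x0 y0 scaler0 addr0.
Qed.
HB.instance Definition _ n := GRing.isSubmodClosed.Build F (g n) (@ker_pred n)
  (GRing.submod_closed_semi (ker_closed n)).
Definition ker_mod n : submodClosed (g n) := @ker_pred n.

Lemma ker_br i j k (p : i + j = k) (x : g i) (y : g j) :
  x \in ker_mod i -> y \in ker_mod j -> br p x y \in ker_mod k.
Proof.
by rewrite !unfold_in /= /ker_pred mf_br => /eqP -> _; rewrite br0l.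
Qed.

Lemma ker_df i j (p : i + 1 = j) (x : g i) :
  x \in ker_mod i -> df p x \in ker_mod j.
Proof. by rewrite !unfold_in /= /ker_pred mf_df => /eqP ->; rewrite df0. Qed.

(* The component at a of the inverse system presenting ker f is the image of
   ker f under the projection g -> g_a. *)
Let S := psys g.

Definition im_pred (a : idx S) n : {pred S a n} :=
  fun y => `[< exists2 x : g n, f n x = 0 & pr a n x = y >].

Lemma im_closed a n : submod_closed (@im_pred a n).
Proof.
split=> [|c x y]; rewrite !unfold_in /im_pred.
  by apply/asboolP; exists 0; rewrite mf_0.
move=> /asboolP[x' fx' <-] /asboolP[y' fy' <-]; apply/asboolP.
by exists (c *: x' + y'); rewrite mf_lin ?fx' ?fy' ?scaler0 ?addr0.
Qed.
HB.instance Definition _ a n := GRing.isSubmodClosed.Build F (S a n)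
  (@im_pred a n) (GRing.submod_closed_semi (im_closed a n)).
Definition im_mod a n : submodClosed (S a n) := @im_pred a n.

Lemma im_modP a n (y : S a n) :
  y \in im_mod a n <-> exists2 x : g n, f n x = 0 & pr a n x = y.
Proof. by split=> [/asboolP|H]; last exact/asboolP. Qed.

Lemma im_br a i j k (p : i + j = k) (x : S a i) (y : S a j) :
  x \in im_mod a i -> y \in im_mod a j -> br p x y \in im_mod a k.
Proof.
move=> /im_modP[x' fx' <-] /im_modP[y' fy' <-]; apply/im_modP.
by exists (br p x' y'); rewrite mf_br // fx' br0l.
Qed.

Lemma im_df a i j (p : i + 1 = j) (x : S a i) :
  x \in im_mod a i -> df p x \in im_mod a j.
Proof.
move=> /im_modP[x' fx' <-]; apply/im_modP.
by exists (df p x'); rewrite mf_df // fx' df0.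
Qed.

Definition ker_dgla : dgla F := subdg ker_br ker_df.
Definition ker_obj a : dgla F := subdg (@im_br a) (@im_df a).

Lemma im_tr a b (p : ile a b) n (x : S b n) :
  x \in im_mod b n -> tr p n x \in im_mod a n.
Proof.
by move=> /im_modP[x' fx' <-]; apply/im_modP; exists x' => //; rewrite pr_compat.
Qed.

Definition ker_tr_fun a b (p : ile a b) n (x : ker_obj b n) : ker_obj a n :=
  exist _ (tr p n (sval x)) (im_tr p (valP x)).

Lemma ker_tr_lin a b (p : ile a b) n : linear (@ker_tr_fun a b p n).
Proof. by move=> c x y; apply: val_inj; exact: mf_lin. Qed.

Lemma ker_tr_br a b (p : ile a b) i j k (q : i + j = k)
    (x : ker_obj b i) (y : ker_obj b j) :
  ker_tr_fun p (br q x y) = br q (ker_tr_fun p x) (ker_tr_fun p y).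
Proof. by apply: val_inj; exact: mf_br. Qed.

Lemma ker_tr_df a b (p : ile a b) i j (q : i + 1 = j) (x : ker_obj b i) :
  ker_tr_fun p (df q x) = df q (ker_tr_fun p x).
Proof. by apply: val_inj; exact: mf_df. Qed.

Definition ker_tr a b (p : ile a b) : dgmap (ker_obj b) (ker_obj a) :=
  DgMap (ker_tr_lin p) (ker_tr_br p) (ker_tr_df p).

Lemma ker_tr_id a (p : ile a a) n (x : ker_obj a n) : ker_tr p n x = x.
Proof. by apply: val_inj; exact: tr_id. Qed.

Lemma ker_tr_comp a b c (p : ile a b) (q : ile b c) (r : ile a c) n
    (x : ker_obj c n) :
  ker_tr p n (ker_tr q n x) = ker_tr r n x.
Proof. by apply: val_inj; exact: tr_comp. Qed.

Definition ker_sys : invsys F :=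
  @InvSys F (idx S) (@ile F S) (@ile_refl F S) (@ile_trans F S)
    (@ile_directed F S) (idx_inhabited S) ker_obj
    (fun a => sub_nilpotent (@im_br a) (@im_df a) (obj_nilpotent a))
    ker_tr ker_tr_id ker_tr_comp.

Lemma im_pr a n (x : g n) : x \in ker_mod n -> pr a n x \in im_mod a n.
Proof. by move=> /eqP fx; apply/im_modP; exists x. Qed.

Definition ker_pr_fun a n (x : ker_dgla n) : ker_obj a n :=
  exist _ (pr a n (sval x)) (im_pr a (valP x)).

Lemma ker_pr_lin a n : linear (@ker_pr_fun a n).
Proof. by move=> c x y; apply: val_inj; exact: mf_lin. Qed.

Lemma ker_pr_br a i j k (q : i + j = k) (x : ker_dgla i) (y : ker_dgla j) :
  ker_pr_fun a (br q x y) = br q (ker_pr_fun a x) (ker_pr_fun a y).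
Proof. by apply: val_inj; exact: mf_br. Qed.

Lemma ker_pr_df a i j (q : i + 1 = j) (x : ker_dgla i) :
  ker_pr_fun a (df q x) = df q (ker_pr_fun a x).
Proof. by apply: val_inj; exact: mf_df. Qed.

Definition ker_pr (a : idx ker_sys) : dgmap ker_dgla (ker_sys a) :=
  DgMap (@ker_pr_lin a) (@ker_pr_br a) (@ker_pr_df a).

Lemma ker_pr_compat a b (p : ile a b) n (x : ker_dgla n) :
  tr p n (ker_pr b n x) = ker_pr a n x.
Proof. by apply: val_inj; exact: pr_compat. Qed.

Lemma ker_pr_limit n (t : forall a, ker_sys a n) :
  (forall a b (p : ile a b), tr p n (t b) = t a) ->
  exists! x : ker_dgla n, forall a, ker_pr a n x = t a.
Proof.
move=> t_compat.
have [a b p|x [xt x_uniq]] := @pr_limit F g n (fun a => sval (t a)).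
  by rewrite -(t_compat a b p).
have fx : f n x = 0.
  have [z [_ z_uniq]] := @pr_limit F h n (fun a => 0) (fun a b p => mf_0 _ _).
  rewrite -(z_uniq (f n x)) ?(z_uniq 0) // => [a|a]; first by rewrite mf_0.
  have [b fb] := pmf_cont f n a.
  have /im_modP[x' fx' x't] := valP (t b).
  have : pr b n (x - x') = 0.
    by rewrite -scaleN1r addrC mf_lin x't xt scaleN1r addNr.
  by move/fb; rewrite -scaleN1r addrC mf_lin fx' scaler0 add0r.
have xP : x \in ker_mod n by apply/eqP.
exists (exist _ x xP); split=> [a|y yt]; first by apply: val_inj; exact: xt.
by apply: val_inj; apply: x_uniq => a; rewrite -yt.
Qed.

(* ker f with the subspace topology *)
Definition pker : pronil F :=
  @Pronil F ker_dgla ker_sys ker_pr ker_pr_compat ker_pr_limit.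

Definition pker_incl : dgmap pker g := sub_incl ker_br ker_df.

End Kernel.

Section Gauge.
Variables (F : fieldType) (g : pronil F).

Definition ad0 n (y : g 0) (x : g n) : g n := br (add0r n) y x.

(* e^y . xi, with the summation index shifted by one *)
Definition gauge (y : g 0) (xi : g 1) : g 1 :=
  xi + psum (fun n => (n.+1)`!%:R^-1 *:
         iter n (ad0 y) (ad0 y xi - df (erefl : 0 + 1 = 1 :> int) y)).

Definition gauge_equiv (x x' : MC g) : Prop :=
  exists y : g 0, val x' = gauge y (val x).

Definition MCmod : Type := classes gauge_equiv.

Definition mcls (x : MC g) : MCmod := cls gauge_equiv x.

End Gauge.

Definition MCmod_map (F : fieldType) (g h : pronil F) (f : pdgmap g h) :
  MCmod g -> MCmod h := classes_map (@gauge_equiv F h) (mc_map f).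

(* Noncommutative formal power series in two letters X = true, Y = false: a
   series is its family of coefficients, indexed by words. *)
Section Words.
Variable F : fieldType.

Definition ncser : Type := seq bool -> F.

Definition nc1 : ncser := fun w => (w == [::])%:R.

Definition ncmul (a b : ncser) : ncser := fun w =>
  \sum_(i < (size w).+1) a (take i w) * b (drop i w).

Definition ncpow (a : ncser) (n : nat) : ncser := iter n (ncmul a) nc1.

Definition ncexp (c : bool) : ncser := fun w =>
  if all (pred1 c) w then (size w)`!%:R^-1 else 0.

(* log a = sum_(k >= 1) (-1)^(k-1)/k (a - 1)^k, for a with constant term 1;
   only the k with k <= size w contribute to the coefficient of w. *)
Definition nclog (a : ncser) : ncser := fun w =>
  \sum_(1 <= k < (size w).+1)
    (-1) ^+ k.-1 / k%:R * ncpow (fun v => a v - nc1 v) k w.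

Definition bch_coef : ncser := nclog (ncmul (ncexp true) (ncexp false)).

End Words.

Section BCH.
Variables (F : fieldType) (g : pronil F).

(* [x1, [x2, ... [x_(n-1), x_n]]], where x_i is x or y according to the i-th
   letter *)
Fixpoint nested_br (x y : g 0) (w : seq bool) : g 0 :=
  match w with
  | [::] => 0
  | [:: c] => if c then x else y
  | c :: w' => ad0 (if c then x else y) (nested_br x y w')
  end.

(* Dynkin's form of log(e^x e^y): each word w of log(e^X e^Y) is replaced by
   1/|w| times the corresponding nested bracket. *)
Definition bch (x y : g 0) : g 0 :=
  psum (fun n => (n.+1)%:R^-1 *:
    \sum_(w : n.+1.-tuple bool) bch_coef F w *: nested_br x y w).

End BCH.

Definition cyc0 (F : fieldType) (L : dgla F) : Type :=
  {z : L 0 | df (erefl : 0 + 1 = 1 :> int) z == 0}.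

Definition cohom0 (F : fieldType) (L : dgla F) (z z' : cyc0 L) : Prop :=
  exists u : L (-1), val z' = val z + df (erefl : -1 + 1 = 0 :> int) u.

Definition H0 (F : fieldType) (L : dgla F) : Type := classes (@cohom0 F L).

Definition hcls (F : fieldType) (L : dgla F) (z : cyc0 L) : H0 L :=
  cls (@cohom0 F L) z.

(* G, together with x |-> e^x, is the group exp(H^0(g)): its elements are the
   e^x for x in H^0(g), multiplied by the Baker-Campbell-Hausdorff product
   induced on H^0(g) by that of the degree 0 cycles. *)
Definition is_expH0 (F : fieldType) (g : pronil F) (G : groupType)
    (e : H0 g -> G) : Prop :=
  bijective e /\
  forall x y : cyc0 g, exists2 z : cyc0 g,
    val z = bch (val x) (val y) & (e (hcls x) * e (hcls y))%g = e (hcls z).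

Definition is_group_action (G : groupType) (T : Type) (act : G -> T -> T) :
    Prop :=
  (forall t, act 1%g t = t) /\
  (forall a b t, act (a * b)%g t = act a (act b t)).

Definition orbit_rel (G T : Type) (act : G -> T -> T) (t t' : T) : Prop :=
  exists a, t' = act a t.

Section TwistedKernel.
Variables (F : fieldType) (charF0 : [pchar F] =i pred0).
Variables (g h : pronil F) (f : pdgmap g h) (xi : MC g) (xi0 : MC h).
Hypothesis fxi : f 1 (val xi) = val xi0.

(* k^xi, as the kernel of f : g^xi -> h^xi0 *)
Definition twker : pronil F := pker (twist_pdgmap charF0 fxi).

Definition twker_val n (x : twker n) : g n :=
  pker_incl (twist_pdgmap charF0 fxi) n x.

(* eta |-> eta + xi, from MC(k^xi) to MC(g) *)
Definition twker_shift (eta : MC twker) : MC g :=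
  mc_shift (mc_map (pker_incl (twist_pdgmap charF0 fxi)) eta).

End TwistedKernel.

(* Main.v *)
Require Import Defs.
From HB Require Import structures.
From mathcomp Require Import all_boot all_order all_algebra.
From mathcomp Require Import monoid ssrAC zify.
From mathcomp Require Import boolp classical_sets functions.

Set Implicit Arguments.
Unset Strict Implicit.
Unset Printing Implicit Defensive.

Import GRing.Theory.
Local Open Scope ring_scope.

(** The Baker-Campbell-Hausdorff product turns the gauge action into a group
    action, and the rest of the argument moves points inside the fibre of
    Maurer-Cartan sets over xi0.

    The fibre of MC(g) -> MC(h) over xi0 is MC(k^xi), shifted by xi
    ([fibre_pt_surj]), and gauge equivalence in k^xi is gauge equivalence in g
    by elements of the kernel ([gauge_equiv_fibre_pt]).  An element of degree 0
    of h fixes xi0 exactly when it is a cycle for the differential twisted by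
    xi0 ([gauge_fix], [twist_cycle_fix]).  A lift y of such a cycle therefore
    preserves the fibre.  Two lifts of the same cycle differ, multiplicatively,
    by an element of the kernel, and a boundary can be lifted to an element
    d^mu W, which fixes mu; so the transformed point has a well-defined class,
    which only depends on the cohomology class of the cycle
    ([lift_acts_equiv]).  Two points of the fibre are gauge equivalent in g
    exactly when they are related by this action ([orb_gauge]), and since f is
    surjective every class of MC(g) over the class of xi0 has a representative
    in the fibre ([fibre_surj]).

    This needs that the product defined by Dynkin's series acts as the product
    of exponentials ([exp_bch]), that it is associative ([lbchA]), and that on
    cycles it is compatible with boundaries ([bch_boundary]).  In each nilpotent
    component the gauge transformation is the exponential of a linear
    representation on (degree 1) + F d ([pr_gauge]).  To prove [exp_bch], the
    elements x, y are replaced by t x, t y in a truncated power series algebra.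
    There G = e^(tx) e^(ty) satisfies t G' = w G with w = tx + e^(ad tx) ty, and
    e^z satisfies the analogous equation with w replaced by its own logarithmic
    derivative (e^(ad z) - 1)/(ad z) (t z') ([euler_exp]).  Dynkin's series says
    that t z' = sum_k (-1)^k/(k+1) (G - 1)^k w ([dynkin]), which is the image of
    w under the inverse of (e^(ad z) - 1)/(ad z), provided that G and e^(ad z)
    agree; this is shown one coefficient at a time ([exp_agree]).
    Associativity follows: the same power series algebra, extended by the
    derivation t d/dt, is a representation in which an element can be recovered
    from its exponential ([tbch_inj]). *)

(** * Finite sums *)

Lemma sum_triangle (V : nmodType) (t : nat -> nat -> V) N :
  \sum_(n < N) \sum_(i < n.+1) t i (n - i)%N
  = \sum_(i < N) \sum_(j < N - i) t i j.
Proof.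
elim: N => [|N IH]; first by rewrite !big_ord0.
rewrite big_ord_recr /= IH [RHS]big_ord_recr /= subSn // subnn big_ord1.
rewrite [X in _ + X]big_ord_recr /= subnn addrA; congr (_ + _).
rewrite -big_split /=; apply: eq_bigr => i _.
by rewrite subSn ?big_ord_recr // ltnW.
Qed.

Lemma big_ord_widen0 (V : nmodType) (t : nat -> V) N M : (N <= M)%N ->
  (forall n, (N <= n)%N -> t n = 0) -> \sum_(i < M) t i = \sum_(i < N) t i.
Proof.
move=> le t0; rewrite [RHS](big_ord_widen M t le) [LHS](bigID (fun i : 'I_M => (i < N)%N)) /=.
by rewrite [X in _ + X]big1 ?addr0 // => i; rewrite -leqNgt => /t0.
Qed.

(** The Cauchy product of two finitely supported families: no term is lost when
    the triangles i + j = n fill the whole support rectangle. *)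
Lemma sum_square (V : nmodType) (t : nat -> nat -> V) N1 N2 N :
  (N1 + N2 <= N)%N ->
  (forall i j, (N1 <= i)%N -> t i j = 0) ->
  (forall i j, (N2 <= j)%N -> t i j = 0) ->
  \sum_(n < N) \sum_(i < n.+1) t i (n - i)%N = \sum_(i < N1) \sum_(j < N2) t i j.
Proof.
move=> le t1 t2; rewrite sum_triangle.
rewrite (@big_ord_widen0 V (fun i => \sum_(j < N - i) t i j) N1) //.
- apply: eq_bigr => i _; apply: big_ord_widen0 => [|j]; last exact: t2.
  have le1 : (i + N2 <= N)%N by apply: leq_trans le; rewrite leq_add2r ltnW.
  by rewrite leq_subRL // (leq_trans (leq_addr _ _) le1).
- exact: leq_trans (leq_addr _ _) le.
- by move=> i le_i; apply: big1 => j _; exact: t1.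
Qed.

(** * Exponentials of nilpotent operators *)

Section Linear.
Variables (F : fieldType) (charF0 : [pchar F] =i pred0).
Implicit Types M A B C : lmodType F.

Lemma natS_neq0 n : (n.+1%:R : F) != 0.
Proof. by rewrite (proj1 (pcharf0P _) charF0). Qed.

Lemma iter_lin M (U : {linear M -> M}) k : linear (iter k U).
Proof. by elim: k => [|k IH] a x y //=; rewrite IH linearP. Qed.
HB.instance Definition _ M (U : {linear M -> M}) k :=
  GRing.isLinear.Build F M M *:%R (iter k U) (iter_lin U k).

(** Evaluation of polynomials at an operator.  It turns power series identities
    into operator identities as soon as the operator is nilpotent. *)
Definition peval M (p : {poly F}) (U : M -> M) (m : M) : M :=
  \sum_(i < size p) p`_i *: iter i U m.

Lemma pevalE M (p : {poly F}) (U : M -> M) m N : (size p <= N)%N ->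
  peval p U m = \sum_(i < N) p`_i *: iter i U m.
Proof.
move=> le; rewrite /peval.
rewrite (@big_ord_widen0 M (fun i => p`_i *: iter i U m) (size p) N) // => n.
by move=> le'; rewrite nth_default ?scale0r.
Qed.

Lemma peval_poly M N E (U : M -> M) m :
  peval (\poly_(i < N) E i) U m = \sum_(i < N) E i *: iter i U m.
Proof.
rewrite (@pevalE M _ U m N) ?size_poly //; apply: eq_bigr => i _.
by rewrite coef_poly ltn_ord.
Qed.

Lemma peval_lin M p (U : {linear M -> M}) : linear (peval p U).
Proof.
move=> a x y; rewrite /peval scaler_sumr -big_split; apply: eq_bigr => i _ /=.
by rewrite iter_lin scalerDr !scalerA mulrC.
Qed.
HB.instance Definition _ M p (U : {linear M -> M}) :=
  GRing.isLinear.Build F M M *:%R (peval p U) (peval_lin p U).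

Lemma pevalDl M p q (U : M -> M) m :
  peval (p + q) U m = peval p U m + peval q U m.
Proof.
pose N := maxn (size p) (size q).
rewrite (@pevalE M (p + q) U m N) ?size_polyD //.
rewrite (@pevalE M p U m N) ?leq_maxl // (@pevalE M q U m N) ?leq_maxr //.
by rewrite -big_split; apply: eq_bigr => i _; rewrite coefD scalerDl.
Qed.

Lemma pevalZl M a p (U : M -> M) m : peval (a *: p) U m = a *: peval p U m.
Proof.
rewrite (@pevalE M (a *: p) U m (size p)) ?size_scale_leq // scaler_sumr.
by apply: eq_bigr => i _; rewrite coefZ scalerA.
Qed.

Lemma peval0 M (U : M -> M) m : peval 0 U m = 0.
Proof. by rewrite /peval size_poly0 big_ord0. Qed.

Lemma peval_sum M I (r : seq I) (P : pred I) (p : I -> {poly F}) (U : M -> M) m :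
  peval (\sum_(i <- r | P i) p i) U m = \sum_(i <- r | P i) peval (p i) U m.
Proof.
by apply: (big_morph (fun p => peval p U m)) => [q q'|]; rewrite (pevalDl, peval0).
Qed.

Lemma pevalC M a (U : M -> M) m : peval a%:P U m = a *: m.
Proof. by rewrite (@pevalE M _ U m 1) ?size_polyC_leq1 // big_ord1 coefC. Qed.

Lemma pevalXM M p (U : {linear M -> M}) m : peval (p * 'X) U m = U (peval p U m).
Proof.
rewrite (@pevalE M _ U m (size p).+1); last first.
  by rewrite (leq_trans (size_polyMleq _ _)) // size_polyX addn2.
rewrite big_ord_recl coefMX scale0r add0r linear_sum; apply: eq_bigr => i _ /=.
by rewrite coefMX linearZ.
Qed.

Lemma pevalM M p q (U : {linear M -> M}) m :
  peval (p * q) U m = peval p U (peval q U m).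
Proof.
elim/poly_ind: p => [|p c IH]; first by rewrite mul0r !peval0.
rewrite mulrDl !pevalDl -mulrA -commr_polyX mulrA !pevalXM IH.
by rewrite mul_polyC pevalZl pevalC.
Qed.

Lemma pevalX M p k (U : {linear M -> M}) m :
  peval (p ^+ k) U m = iter k (peval p U) m.
Proof.
elim: k m => [|k IH] m; first by rewrite expr0 pevalC scale1r.
by rewrite exprS pevalM IH.
Qed.

Lemma pevalXn M k (U : {linear M -> M}) m : peval 'X^k U m = iter k U m.
Proof.
by elim: k => [|k IH]; rewrite ?expr0 ?pevalC ?scale1r // exprSr pevalXM IH.
Qed.

(** Truncations of e^U, of (e^U - 1)/U, and of the series
    log V/(V - 1) = sum_k (-1)^k/(k+1) (V - 1)^k.  They are exact once the
    N-th power of U, respectively of V - 1, vanishes. *)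
Definition expo M N (U : M -> M) m : M := \sum_(k < N) k`!%:R^-1 *: iter k U m.
Definition phio M N (U : M -> M) m : M := \sum_(k < N) k.+1`!%:R^-1 *: iter k U m.
Definition psio M N (V : M -> M) m : M :=
  \sum_(k < N) ((-1) ^+ k / k.+1%:R) *: iter k (fun v => V v - v) m.

Lemma expo_lin M N (U : {linear M -> M}) : linear (expo N U).
Proof.
move=> a x y; rewrite /expo scaler_sumr -big_split; apply: eq_bigr => i _ /=.
by rewrite iter_lin scalerDr !scalerA mulrC.
Qed.
HB.instance Definition _ M N (U : {linear M -> M}) :=
  GRing.isLinear.Build F M M *:%R (expo N U) (expo_lin N U).

Lemma iter0_le M (U : {linear M -> M}) N m k :
  (N <= k)%N -> (forall m, iter N U m = 0) -> iter k U m = 0.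
Proof. by move=> /subnK <- U0; rewrite iterD U0 linear0. Qed.

Lemma expo_widen M N N' (U : {linear M -> M}) m : (N <= N')%N ->
  (forall m, iter N U m = 0) -> expo N' U m = expo N U m.
Proof.
move=> le U0; apply: (big_ord_widen0 (t := fun k => k`!%:R^-1 *: iter k U m)) => //.
by move=> n le_n; rewrite (iter0_le m le_n U0) scaler0.
Qed.

(** The series log(1 + v)/v at v = e^u - 1 is inverse to (e^u - 1)/u.  With
    g = sum_k (-1)^k/(k+1) v^k, the derivative of g v is the truncated geometric
    series of -v times v' = e^u = 1 + v, hence 1 modulo u^N; integrating, g v
    agrees with u through degree N, and one divides by u. *)
Lemma psi_phi_poly N :
  let f : {poly F} := \poly_(i < N) i.+1`!%:R^-1 in
  exists q, \sum_(k < N) ((-1) ^+ k / k.+1%:R) *: (f * 'X) ^+ k * f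
    = 1 + q * 'X^N.
Proof.
move=> f; pose v := f * 'X; pose g := \sum_(k < N) ((-1) ^+ k / k.+1%:R) *: v ^+ k.
have fE : v^`() = 1 + v - (N`!%:R^-1 *: 'X^N).
  apply/polyP => i; rewrite coef_deriv coefMX /= coef_poly.
  rewrite coefB coefD coefMX coef1 coefZ coefXn coef_poly.
  case: (ltngtP i N) => [lt|gt|->].
  - case: i lt => [|i] lt; first by rewrite /= mulr0 subr0 addr0 invr1.
    rewrite /= (ltnW lt) mulr0 subr0 add0r -[LHS]mulr_natr (factS i.+1) natrM.
    by rewrite invfM mulrAC mulVf ?natS_neq0 // mul1r.
  - case: i gt => [|i] gt //=.
    by rewrite mul0rn mulr0 subr0 add0r ltnNge -ltnS gt.
  - case: (N) => [|N'] /=; first by rewrite invr1 mulr1 addr0 subrr mul0rn.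
    by rewrite ltnSn mulr1 add0r subrr mul0rn.
pose S := \sum_(k < N) (- v) ^+ k.
have SE : S * (1 + v) = 1 - (- v) ^+ N.
  rewrite mulrC (_ : 1 + v = - (- v - 1)); last by rewrite opprB opprK.
  by rewrite mulNr -subrX1 opprB.
have gvE : (g * v)^`() = 1 + (- (- f) ^+ N - N`!%:R^-1 *: S) * 'X^N.
  have -> : (g * v)^`() = S * v^`().
    rewrite /g mulr_suml linear_sum mulr_suml; apply: eq_bigr => k _.
    rewrite -scalerAl -exprSr /= derivZ deriv_exp /= -scaler_nat scalerA.
    rewrite (divfK (natS_neq0 k)) [in RHS](exprNn v) -[in RHS]mulrA.
    rewrite -signr_odd scaler_sign -[in RHS]signr_odd mulr_sign.
    by rewrite [v^`() * _]mulrC.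
  rewrite fE mulrBr SE mulrBl -addrA; congr (_ + _).
  by rewrite /v -(mulNr f) exprMn mulNr -scalerAl scalerAr.
have gfE i : (i < N)%N -> (g * f)`_i = (i == 0%N)%:R.
  move=> lt; apply: (mulIf (natS_neq0 i)).
  have := congr1 (fun p : {poly F} => p`_i) gvE.
  rewrite /= coef_deriv coefD coef1 coefMXn lt addr0 mulrA coefMX /=.
  by rewrite mulr_natr => ->; case: i lt => [|i] _; rewrite ?mulr1 ?mul0r.
exists (drop_poly N (g * f - 1)).
rewrite -mulr_suml -/v -/g -[LHS](subrK 1) addrC; congr (_ + _).
rewrite -[LHS](poly_take_drop N) [take_poly _ _](_ : _ = 0) ?add0r //.
apply/polyP => i; rewrite coef_take_poly coef0; case: ltnP => // lt.
by rewrite coefB gfE // coef1 subrr.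
Qed.

Lemma eq_iter_fun M (U V : M -> M) k : U =1 V -> iter k U =1 iter k V.
Proof. by move=> UV m; elim: k => //= k ->; rewrite UV. Qed.

Section PsiPhi.
Variables (M : lmodType F) (N : nat) (U : {linear M -> M}).
Hypothesis U0 : forall m, iter N U m = 0.
Let f : {poly F} := \poly_(i < N) i.+1`!%:R^-1.

Lemma phio_peval m : phio N U m = peval f U m.
Proof. by rewrite peval_poly. Qed.

Lemma expo_sub m : expo N U m - m = U (phio N U m).
Proof.
rewrite /expo /phio linear_sum; case: N U0 => [|N'] U0'.
  by rewrite !big_ord0 -[m]/(iter 0 U m) U0' subrr.
rewrite big_ord_recl [RHS]big_ord_recr [in RHS]linearZ /= -[U (iter N' U m)]/(iter N'.+1 U m).
rewrite U0' scaler0 addr0 addrAC -[X in _ = X]add0r; congr (_ + _).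
  by rewrite invr1 scale1r subrr.
apply: eq_bigr => i _; rewrite linearZ /=.
by rewrite /bump.
Qed.

Lemma psio_peval m : psio N (expo N U) m =
  peval (\sum_(k < N) ((-1) ^+ k / k.+1%:R) *: (f * 'X) ^+ k) U m.
Proof.
rewrite peval_sum; apply: eq_bigr => k _; rewrite pevalZl pevalX; congr (_ *: _).
by apply: eq_iter_fun => v; rewrite expo_sub phio_peval pevalXM.
Qed.

Lemma psi_phi m : psio N (expo N U) (phio N U m) = m.
Proof.
rewrite psio_peval phio_peval -pevalM mulr_suml.
have [q ->] := psi_phi_poly N.
by rewrite pevalDl pevalC scale1r pevalM pevalXn U0 linear0 addr0.
Qed.

Lemma phi_psi m : phio N U (psio N (expo N U) m) = m.
Proof. by rewrite psio_peval phio_peval -pevalM mulrC pevalM -phio_peval -psio_peval psi_phi. Qed.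
End PsiPhi.

Section Bilinear.
Variables (A B C : lmodType F) (b : A -> B -> C).
Hypothesis b_linl : forall y, linear (b^~ y).
Hypothesis b_linr : forall x, linear (b x).
Variables (D1 : {linear A -> A}) (D2 : {linear B -> B}) (D3 : {linear C -> C}).
Hypothesis bD : forall x y, D3 (b x y) = b (D1 x) y + b x (D2 y).
Variables N1 N2 N3 : nat.
Hypothesis nil1 : forall x, iter N1 D1 x = 0.
Hypothesis nil2 : forall x, iter N2 D2 x = 0.
Hypothesis nil3 : forall x, iter N3 D3 x = 0.

Let bl y : {linear A -> C} :=
  HB.pack (b^~ y) (GRing.isLinear.Build F A C *:%R (b^~ y) (b_linl y)).
Let br_ x : {linear B -> C} :=
  HB.pack (b x) (GRing.isLinear.Build F B C *:%R (b x) (b_linr x)).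

Let dp M (D : M -> M) m k : M := k`!%:R^-1 *: iter k D m.

Let dpS M (D : {linear M -> M}) m k : D (dp D m k) = k.+1%:R *: dp D m k.+1.
Proof.
rewrite /dp linearZ scalerA factS natrM invfM mulrA mulfV ?natS_neq0 //.
by rewrite mul1r.
Qed.

(** Leibniz rule for the divided powers D^n/n!. *)
Lemma dp_bil x y n :
  dp D3 (b x y) n = \sum_(i < n.+1) b (dp D1 x i) (dp D2 y (n - i)).
Proof.
elim: n => [|n IH]; first by rewrite big_ord1 /dp /= invr1 !scale1r.
apply: (scalerI (natS_neq0 n)); rewrite -dpS IH linear_sum /=.
under eq_bigr => i _ do rewrite bD dpS dpS.
rewrite big_split /=.
have -> : \sum_(i < n.+1) b (i.+1%:R *: dp D1 x i.+1) (dp D2 y (n - i))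
    = \sum_(i < n.+2) i%:R *: b (dp D1 x i) (dp D2 y (n.+1 - i)).
  rewrite [RHS]big_ord_recl scale0r add0r; apply: eq_bigr => i _.
  by rewrite -[LHS]/(bl _ _) linearZ.
have -> : \sum_(i < n.+1) b (dp D1 x i) ((n - i).+1%:R *: dp D2 y (n - i).+1)
    = \sum_(i < n.+2) (n.+1 - i)%:R *: b (dp D1 x i) (dp D2 y (n.+1 - i)).
  rewrite [RHS]big_ord_recr /= subnn scale0r addr0; apply: eq_bigr => i _.
  by rewrite -[LHS]/(br_ _ _) linearZ /= subSn // -ltnS.
rewrite -big_split scaler_sumr; apply: eq_bigr => i _ /=.
by rewrite -scalerDl -natrD subnKC // -ltnS.
Qed.

(** The exponential of a derivation is multiplicative.  All the invariance
    properties of exponentials used below (conjugation, the logarithmic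
    derivative, the curvature) are instances of this statement, for different
    pairings b. *)
Lemma expo_bil x y : expo N3 D3 (b x y) = b (expo N1 D1 x) (expo N2 D2 y).
Proof.
pose N := maxn N3 (N1 + N2).
rewrite -(@expo_widen _ N3 N) ?leq_maxl // /expo.
rewrite -[LHS]/(\sum_(n < N) dp D3 (b x y) n).
under eq_bigr => n _ do rewrite dp_bil.
rewrite (@sum_square _ (fun i j => b (dp D1 x i) (dp D2 y j)) N1 N2) ?leq_maxr //.
- rewrite -[RHS]/(bl _ _) linear_sum; apply: eq_bigr => i _ /=.
  by rewrite -[RHS]/(br_ _ _) linear_sum.
- move=> i j le; rewrite /dp (iter0_le x le) // scaler0.
  by rewrite -[LHS]/(bl _ _) linear0.
- move=> i j le; rewrite /dp (iter0_le y le) // scaler0.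
  by rewrite -[LHS]/(br_ _ _) linear0.
Qed.
End Bilinear.
End Linear.

(** * Filtered nilpotent Lie algebras and their representations *)

(** A Lie algebra with a decreasing filtration, zero from [lnil] on, for which
    brackets raise the filtration by one more than the sum of the indices, as
    for the lower central series (whose n-th term is spanned by the brackets of
    n + 1 elements). *)
Record nlie (F : fieldType) : Type := NLie {
  lcar :> lmodType F;
  lb : lcar -> lcar -> lcar;
  lb_linl : forall y, linear (lb^~ y);
  lb_linr : forall x, linear (lb x);
  lb_anti : forall x y, lb x y = - lb y x;
  lb_jacobi : forall x y z, lb x (lb y z) = lb (lb x y) z + lb y (lb x z);
  lfil : nat -> lcar -> Prop;
  lfil0 : forall x, lfil 0 x;
  lfil_dec : forall n x, lfil n.+1 x -> lfil n x;
  lfil_lin : forall n a x y, lfil n x -> lfil n y -> lfil n (a *: x + y);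
  lfil_br : forall i j x y, lfil i x -> lfil j y -> lfil (i + j).+1 (lb x y);
  lnil : nat;
  lfil_nil : forall n x, (lnil <= n)%N -> lfil n x -> x = 0
}.

(** Every product of [rnil] actions vanishes, so exponentials of actions are
    finite sums. *)
Record nrep (F : fieldType) (L : nlie F) : Type := NRep {
  rcar :> lmodType F;
  ra : L -> rcar -> rcar;
  ra_linl : forall m, linear (ra^~ m);
  ra_linr : forall x, linear (ra x);
  ra_br : forall x y m, ra (lb x y) m = ra x (ra y m) - ra y (ra x m);
  rfil : nat -> rcar -> Prop;
  rfil0 : forall m, rfil 0 m;
  rfil_dec : forall n m, rfil n.+1 m -> rfil n m;
  rfil_lin : forall n a m m', rfil n m -> rfil n m' -> rfil n (a *: m + m');
  rfil_ra : forall i j x m, lfil i x -> rfil j m -> rfil (i + j).+1 (ra x m);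
  rnil : nat;
  rfil_nil : forall n m, (rnil <= n)%N -> rfil n m -> m = 0
}.

HB.instance Definition _ (F : fieldType) (L : nlie F) x :=
  GRing.isLinear.Build F L L *:%R (@lb F L x) (@lb_linr F L x).
HB.instance Definition _ (F : fieldType) (L : nlie F) (M : nrep L) x :=
  GRing.isLinear.Build F M M *:%R (@ra F L M x) (@ra_linr F L M x).

Section Basics.
Variables (F : fieldType) (L : nlie F).
Implicit Types M : nrep L.

Lemma ad_br (x y m : L) : lb (lb x y) m = lb x (lb y m) - lb y (lb x m).
Proof. by rewrite lb_jacobi addrK. Qed.

Definition adrep : nrep L :=
  @NRep F L L (@lb F L) (@lb_linl F L) (@lb_linr F L) ad_br (@lfil F L)
    (@lfil0 F L) (@lfil_dec F L) (@lfil_lin F L) (@lfil_br F L) (lnil L)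
    (@lfil_nil F L).

Lemma ra0l M (m : M) : ra 0 m = 0.
Proof. by have := ra_linl m 1 0 0; rewrite !scale1r addr0 => /idem0. Qed.
Lemma raDl M x y (m : M) : ra (x + y) m = ra x m + ra y m.
Proof. by have := ra_linl m 1 x y; rewrite !scale1r. Qed.
Lemma raZl M a x (m : M) : ra (a *: x) m = a *: ra x m.
Proof. by have := ra_linl m a x 0; rewrite ra0l !addr0. Qed.
Lemma ra_suml M I (r : seq I) (P : pred I) (x : I -> L) (m : M) :
  ra (\sum_(i <- r | P i) x i) m = \sum_(i <- r | P i) ra (x i) m.
Proof. by apply: (big_morph (fun x => ra x m)) => [y z|]; rewrite ?raDl ?ra0l. Qed.

Lemma raBr M x (m m' : M) : ra x (m - m') = ra x m - ra x m'.
Proof. exact: linearB. Qed.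
Lemma raDr M x (m m' : M) : ra x (m + m') = ra x m + ra x m'.
Proof. exact: linearD. Qed.
Lemma raZr M x a (m : M) : ra x (a *: m) = a *: ra x m.
Proof. exact: linearZ. Qed.
Lemma ra0r M x : ra x (0 : M) = 0.
Proof. exact: linear0. Qed.

Lemma rfil_le M n k (m : M) : (n <= k)%N -> rfil k m -> rfil n m.
Proof. by move=> /subnK <-; elim: (k - n)%N => // j IH /rfil_dec. Qed.

Lemma rfil_zero M n : rfil n (0 : M).
Proof.
apply: (@rfil_le _ n (maxn n (rnil M))); first exact: leq_maxl.
elim: (maxn _ _) => [|j IH]; first exact: rfil0.
by have := rfil_ra (lfil0 (0 : L)) IH; rewrite ra0l.
Qed.

Lemma rfilZ M n a (m : M) : rfil n m -> rfil n (a *: m).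
Proof. by move=> nm; rewrite -[_ *: _]addr0; apply: rfil_lin => //; exact: rfil_zero. Qed.
Lemma rfilD M n (m m' : M) : rfil n m -> rfil n m' -> rfil n (m + m').
Proof. by move=> nm nm'; rewrite -[m]scale1r; exact: rfil_lin. Qed.
Lemma rfil_sum M n I (r : seq I) (P : pred I) (m : I -> M) :
  (forall i, P i -> rfil n (m i)) -> rfil n (\sum_(i <- r | P i) m i).
Proof.
move=> H; apply: (big_ind (@rfil F L M n)) => //; first exact: rfil_zero.
by move=> ? ?; exact: rfilD.
Qed.

Lemma rfil_iter M x k (m : M) : rfil k (iter k (ra x) m).
Proof.
elim: k => [|k IH]; first exact: rfil0.
exact: (rfil_ra (lfil0 x) IH).
Qed.

Lemma ra_nil M x k (m : M) : (rnil M <= k)%N -> iter k (ra x) m = 0.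
Proof. by move=> le; apply: rfil_nil le _; exact: rfil_iter. Qed.

(** [rexp x] is e^x on M and [rphi x] is (e^x - 1)/x on M. *)
Definition rexp M x (m : M) : M := expo (rnil M) (ra x) m.
Definition rphi M x (m : M) : M := phio (rnil M) (ra x) m.

HB.instance Definition _ M x :=
  GRing.isLinear.Build F M M *:%R (@rexp M x) (expo_lin (rnil M) (@ra F L M x)).

Lemma rexpE M N x (m : M) : (rnil M <= N)%N -> rexp x m = expo N (ra x) m.
Proof.
by move=> le; rewrite /rexp (@expo_widen F _ (rnil M) N) // => v; exact: ra_nil.
Qed.

Lemma rphiE M N x (m : M) : (rnil M <= N)%N -> rphi x m = phio N (ra x) m.
Proof.
move=> le; rewrite /rphi /phio.
rewrite [RHS](@big_ord_widen0 _ (fun k => k.+1`!%:R^-1 *: iter k (ra x) m) (rnil M)) //.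
by move=> n le_n; rewrite ra_nil ?scaler0.
Qed.

Lemma rexp_sub M x (m : M) : rexp x m - m = ra x (rphi x m).
Proof. by apply: expo_sub => v; exact: ra_nil. Qed.

Fixpoint lnested (x y : L) (w : seq bool) : L :=
  match w with
  | [::] => 0
  | [:: c] => if c then x else y
  | c :: w' => lb (if c then x else y) (lnested x y w')
  end.

Lemma lnestedS x y c w : w != [::] ->
  lnested x y (c :: w) = lb (if c then x else y) (lnested x y w).
Proof. by case: w. Qed.

(** Dynkin's form of the Baker-Campbell-Hausdorff series; it is a finite sum
    because a nested bracket of n + 1 letters lies in filtration n. *)
Definition lbch (x y : L) : L :=
  \sum_(n < lnil L) (n.+1)%:R^-1 *:
    \sum_(w : n.+1.-tuple bool) bch_coef F w *: lnested x y w.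

Lemma lfil_nested x y w : lfil (size w).-1 (lnested x y w).
Proof.
elim: w => [|c w IH]; first exact: lfil0.
case: (eqVneq w [::]) => [->|w0]; first exact: lfil0.
rewrite lnestedS //.
have := lfil_br (lfil0 (if c then x else y)) IH.
by rewrite add0n; case: w w0 {IH}.
Qed.

Lemma lnested_nil x y w : (lnil L < size w)%N -> lnested x y w = 0.
Proof.
by move=> lt; apply: lfil_nil (lfil_nested x y w); rewrite -ltnS (ltn_predK lt).
Qed.

Lemma lbchE N x y : (lnil L <= N)%N ->
  lbch x y = \sum_(n < N) (n.+1)%:R^-1 *:
    \sum_(w : n.+1.-tuple bool) bch_coef F w *: lnested x y w.
Proof.
move=> le; rewrite /lbch.
rewrite [RHS](@big_ord_widen0 _ (fun n : nat => (n.+1)%:R^-1 *: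
    \sum_(w : n.+1.-tuple bool) bch_coef F w *: lnested x y w) (lnil L)) //.
move=> n le_n; rewrite big1 ?scaler0 // => w _.
by rewrite lnested_nil ?scaler0 // size_tuple.
Qed.

End Basics.

Lemma lnested_rel (F : fieldType) (L L' : nlie F) (R : L -> L' -> Prop) :
  (forall x x' y y', R x x' -> R y y' -> R (lb x y) (lb x' y')) -> R 0 0 ->
  forall x x' y y' w, R x x' -> R y y' -> R (lnested x y w) (lnested x' y' w).
Proof.
move=> Rb R0 x x' y y' w Rx Ry; elim: w => [|c w IH] //.
case: (eqVneq w [::]) => [->|w0]; first by case: c.
by rewrite !lnestedS //; apply: Rb => //; case: c.
Qed.

Lemma rel_sum (F : fieldType) (V V' : lmodType F) (R : V -> V' -> Prop) :
  R 0 0 -> (forall a x x' y y', R x x' -> R y y' -> R (a *: x + y) (a *: x' + y')) ->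
  forall I (r : seq I) (P : pred I) (a : I -> F) x x', (forall i, P i -> R (x i) (x' i)) ->
  R (\sum_(i <- r | P i) a i *: x i) (\sum_(i <- r | P i) a i *: x' i).
Proof.
move=> R0 Rl I r P a x x' Rx; elim: r => [|i r IH]; first by rewrite !big_nil.
by rewrite !big_cons; case: ifP => // Pi; apply: Rl => //; exact: Rx.
Qed.

(** Naturality of the product in its most flexible form.  The relation R may be
    the graph of a partially defined homomorphism. *)
Lemma lbch_rel (F : fieldType) (L L' : nlie F) (R : L -> L' -> Prop) :
  R 0 0 -> (forall a x x' y y', R x x' -> R y y' -> R (a *: x + y) (a *: x' + y')) ->
  (forall x x' y y', R x x' -> R y y' -> R (lb x y) (lb x' y')) ->
  forall x x' y y', R x x' -> R y y' -> R (lbch x y) (lbch x' y').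
Proof.
move=> R0 Rl Rb x x' y y' Rx Ry; pose N := maxn (lnil L) (lnil L').
rewrite (@lbchE _ L N) ?leq_maxl // (@lbchE _ L' N) ?leq_maxr //.
apply: rel_sum => // n _; apply: rel_sum => // w _; exact: lnested_rel.
Qed.

Lemma rexp_rel (F : fieldType) (L L' : nlie F) (M : nrep L) (M' : nrep L')
  (R : M -> M' -> Prop) x x' : R 0 0 ->
  (forall a m m' n n', R m m' -> R n n' -> R (a *: m + n) (a *: m' + n')) ->
  (forall m m', R m m' -> R (ra x m) (ra x' m')) ->
  forall m m', R m m' -> R (rexp x m) (rexp x' m').
Proof.
move=> R0 Rl Ra m m' Rm; pose N := maxn (rnil M) (rnil M').
rewrite (@rexpE _ _ M N) ?leq_maxl // (@rexpE _ _ M' N) ?leq_maxr //.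
apply: rel_sum => // k _.
by elim: (nat_of_ord k) => //= j IH; exact: Ra.
Qed.

(** The representation on the sum of M and the ground field F defined by a 1-cocycle
    d : L -> M, namely x (m, c) = (x m - c d(x), 0).  It is the linear form of
    an affine action: e^x (m, 1) = (m', 1) where m' is given by the gauge
    formula.  With d the differential of a dgla it yields the gauge action; with
    d = t d/dt it detects the elements of an algebra of power series. *)
Section Affine.
Variables (F : fieldType) (L : nlie F) (M : nrep L) (dl : L -> M).
Hypothesis dl_lin : linear dl.
Hypothesis dl_br : forall x y, dl (lb x y) = ra x (dl y) - ra y (dl x).
Hypothesis dl_fil : forall i x, lfil i x -> rfil i (dl x).

Definition affine_act (x : L) (p : M * F^o) : M * F^o := (ra x p.1 - p.2 *: dl x, 0).

Lemma affine_act_linl p : linear (affine_act^~ p).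
Proof.
move=> a x y; rewrite /affine_act; congr (_, _) => /=; last by rewrite scaler0 addr0.
rewrite raDl raZl dl_lin scalerDr scalerBr opprD !scalerA [p.2 * a]mulrC.
by rewrite addrACA.
Qed.

Lemma affine_act_linr x : linear (affine_act x).
Proof.
move=> a p q; rewrite /affine_act; congr (_, _) => /=; last by rewrite scaler0 addr0.
rewrite linearP scalerDl scalerBr opprD !scalerA.
by rewrite addrACA.
Qed.

Lemma affine_act_br x y p : affine_act (lb x y) p = affine_act x (affine_act y p) - affine_act y (affine_act x p).
Proof.
rewrite /affine_act; congr (_, _) => /=; last by rewrite subr0.
rewrite !scale0r !subr0 ra_br dl_br !raBr !raZr scalerBr !opprB.
by rewrite [LHS](AC (2*2) (1*4*(3*2))).
Qed.

Definition affine_fil n (p : M * F^o) : Prop :=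
  if n is k.+1 then rfil k p.1 /\ p.2 = 0 else True.

Lemma affine_fil_dec n p : affine_fil n.+1 p -> affine_fil n p.
Proof. by case: n => //= n [/rfil_dec]. Qed.

Lemma affine_fil_lin n a p q : affine_fil n p -> affine_fil n q -> affine_fil n (a *: p + q).
Proof.
case: n => //= n [p1 p2] [q1 q2]; split; first exact: rfil_lin.
by rewrite p2 q2 scaler0 addr0.
Qed.

Lemma affine_fil_act i j x p : lfil i x -> affine_fil j p -> affine_fil (i + j).+1 (affine_act x p).
Proof.
move=> xi; case: j => [_|j [p1 p2]] /=; split => //.
  rewrite addn0; apply: rfilD; first by apply: rfil_dec; rewrite -[i]addn0; apply: rfil_ra xi (rfil0 _).
  by rewrite -scaleNr; apply: rfilZ; exact: dl_fil.
by rewrite p2 scale0r subr0 addnS; exact: rfil_ra.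
Qed.

Lemma affine_fil_nil n p : ((rnil M).+1 <= n)%N -> affine_fil n p -> p = 0.
Proof.
by case: n => // n le [/(rfil_nil le) p1 p2]; case: p p1 p2 => p q /= -> ->.
Qed.

Definition affine_rep : nrep L :=
  @NRep F L (M * F^o)%type affine_act affine_act_linl affine_act_linr affine_act_br affine_fil
    (fun=> I) affine_fil_dec affine_fil_lin affine_fil_act (rnil M).+1 affine_fil_nil.

Lemma rexp_affine x (m : M) (c : F) : @rexp F L affine_rep x (m, c)
  = (m + \sum_(k < rnil M) k.+1`!%:R^-1 *: iter k (ra x) (ra x m - c *: dl x), c).
Proof.
have it k : iter k.+1 (@ra F L affine_rep x) (m, c) = (iter k (ra x) (ra x m - c *: dl x), 0).
  by elim: k => [|k IH] //=; rewrite [LHS]/(@ra F L affine_rep x _) -/(iter k.+1 _ _) IH /= /affine_act /= scale0r subr0.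
rewrite /rexp /expo big_ord_recl invr1 scale1r.
under eq_bigr => i _ do rewrite lift0 it.
have -> (G : nat -> M) n :
    \sum_(i < n) i.+1`!%:R^-1 *: ((G i, 0) : M * F^o)
    = (\sum_(i < n) i.+1`!%:R^-1 *: G i, 0).
  elim: n => [|n IH]; first by rewrite !big_ord0.
  by rewrite !big_ord_recr /= IH; congr (_, _); rewrite /= scaler0 addr0.
by congr (_, _); rewrite addr0.
Qed.

Lemma rexp_affine_phi x (m : M) c : @rexp F L affine_rep x (m, c)
  = (rexp x m - c *: rphi x (dl x), c).
Proof.
rewrite rexp_affine -[rexp x m](subrK m) rexp_sub [_ + m]addrC -addrA.
congr (m + _, _); rewrite /rphi /phio linear_sum scaler_sumr -sumrB.
apply: eq_bigr => i _.
have -> : iter i (ra x) (ra x m - c *: dl x)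
    = ra x (iter i (ra x) m) - c *: iter i (ra x) (dl x).
  by rewrite -iterS iterSr linearB linearZ.
rewrite -[X in _ = X - _]/(ra x _) raZr scalerBr !scalerA.
by rewrite [c * _]mulrC.
Qed.

End Affine.

(** * Truncated formal power series *)

Section TruncatedProduct.
Variables (F : fieldType) (K : nat).
Implicit Types A B C D E : lmodType F.

(** The product of the series sum_i a_i t^(i+1) and sum_j m_j t^j, truncated so
    that the coefficients of index at least K vanish.  When a bracket of two Lie
    series is computed, the second series and the result are indexed with the
    same shift by one as the first. *)
Definition tconv A B C (b : A -> B -> C) (a : nat -> A) (m : nat -> B) : nat -> C :=
  fun n => if (n < K)%N then
    \sum_(i < K) \sum_(j < K | (i + j).+1 == n) b (a i) (m j) else 0.

Lemma tconv_linl A B C (b : A -> B -> C) m : (forall y, linear (b^~ y)) ->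
  linear (fun a : nat -> A => tconv b a m).
Proof.
move=> bl c x y; apply/funext => n.
rewrite -[RHS]/(c *: tconv b x m n + tconv b y m n) /tconv.
case: ifP => _; last by rewrite scaler0 addr0.
rewrite scaler_sumr -big_split; apply: eq_bigr => i _ /=.
by rewrite scaler_sumr -big_split; apply: eq_bigr => j _ /=; exact: bl.
Qed.

Lemma tconv_linr A B C (b : A -> B -> C) a : (forall x, linear (b x)) ->
  linear (fun m : nat -> B => tconv b a m).
Proof.
move=> bl c x y; apply/funext => n.
rewrite -[RHS]/(c *: tconv b a x n + tconv b a y n) /tconv.
case: ifP => _; last by rewrite scaler0 addr0.
rewrite scaler_sumr -big_split; apply: eq_bigr => i _ /=.
by rewrite scaler_sumr -big_split; apply: eq_bigr => j _ /=; exact: bl.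
Qed.

(** The triple products, to which both ways of iterating [tconv] reduce. *)
Definition tconv3 A B C D (t : A -> B -> C -> D) (a : nat -> A) (b : nat -> B)
    (c : nat -> C) : nat -> D :=
  fun n => if (n < K)%N then
    \sum_(i < K) \sum_(j < K) \sum_(k < K | (i + j + k).+2 == n) t (a i) (b j) (c k)
  else 0.

Lemma tconvr A B C D E (b : A -> E -> D) (c : B -> C -> E) x y z :
  (forall x, linear (b x)) ->
  tconv b x (tconv c y z) = tconv3 (fun x y z => b x (c y z)) x y z.
Proof.
move=> bl; apply/funext => n; rewrite /tconv /tconv3; case: ifP => // nK.
apply: eq_bigr => i _.
pose bi : {linear E -> D} :=
  HB.pack (b (x i)) (GRing.isLinear.Build F E D *:%R (b (x i)) (bl (x i))).
under eq_bigr => l _.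
  rewrite ltn_ord -[b _ _]/(bi _) linear_sum.
  under eq_bigr => j _ do rewrite linear_sum.
  over.
rewrite exchange_big; apply: eq_bigr => j _ /=.
rewrite (exchange_big_dep xpredT) //= [RHS]big_mkcond; apply: eq_bigr => k _ /=.
rewrite (eq_bigl (fun l : 'I_K => ((i + j + k).+2 == n) && (l == (j + k).+1 :> nat))); last first.
  by move=> l /=; apply/idP/idP; lia.
rewrite (big_ord1_cond_eq _ (fun=> b (x i) (c (y j) (z k))) (fun=> (i + j + k).+2 == n)).
by case: (@eqP _ _ n) => [e|_]; rewrite ?andbF ?andbT //; case: ifP => //; lia.
Qed.

Lemma tconvl A B C D E (b : E -> C -> D) (c : A -> B -> E) x y z :
  (forall z, linear (b^~ z)) ->
  tconv b (tconv c x y) z = tconv3 (fun x y z => b (c x y) z) x y z.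
Proof.
move=> bl; apply/funext => n; rewrite /tconv /tconv3; case: ifP => // nK.
under eq_bigr => l _ do rewrite big_mkcond.
rewrite exchange_big /=.
under [RHS]eq_bigr => i _.
  under eq_bigr => j _ do rewrite big_mkcond /=.
  rewrite exchange_big; over.
rewrite [RHS]exchange_big; apply: eq_bigr => k _ /=.
pose bk : {linear E -> D} :=
  HB.pack (b^~ (z k)) (GRing.isLinear.Build F E D *:%R (b^~ (z k)) (bl (z k))).
rewrite -big_mkcond /=.
under eq_bigr => l _.
  rewrite ltn_ord -[b _ _]/(bk _) linear_sum.
  under eq_bigr => j _ do rewrite linear_sum big_mkcond.
  over.
rewrite exchange_big; apply: eq_bigr => i _ /=.
rewrite exchange_big; apply: eq_bigr => j _ /=.
rewrite -big_mkcondr.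
rewrite (eq_bigl (fun l : 'I_K => ((i + j + k).+2 == n) && (l == (i + j).+1 :> nat))); last first.
  by move=> l /=; apply/idP/idP; lia.
rewrite (big_ord1_cond_eq _ (fun=> b (c (x i) (y j)) (z k)) (fun=> (i + j + k).+2 == n)).
by case: (@eqP _ _ n) => [e|_]; rewrite ?andbF ?andbT //; case: ifP => //; lia.
Qed.

Lemma tconv3_swap A B C D (t : A -> B -> C -> D) x y z :
  tconv3 t x y z = tconv3 (fun y x z => t x y z) y x z.
Proof.
apply/funext => n; rewrite /tconv3; case: ifP => // _.
rewrite exchange_big; apply: eq_bigr => j _; apply: eq_bigr => i _.
by apply: eq_bigl => k; rewrite [(i + j)%N]addnC.
Qed.

Lemma tconv3D A B C D (t u v : A -> B -> C -> D) x y z :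
  (forall x y z, t x y z = u x y z + v x y z) ->
  tconv3 t x y z = tconv3 u x y z + tconv3 v x y z.
Proof.
move=> euler; apply/funext => n.
rewrite -[RHS]/(tconv3 u x y z n + tconv3 v x y z n) /tconv3.
case: ifP => _; last by rewrite addr0.
do 3! (rewrite -big_split; apply: eq_bigr => ? _ /=); exact: euler.
Qed.

(** The filtration by the order in t.  The truncation only affects products, so
    coefficients of index at least K are required to vanish in positive
    filtration. *)
Definition tfil A n (a : nat -> A) : Prop :=
  n = 0%N \/ forall i, (i < n)%N || (K <= i)%N -> a i = 0.

Lemma tfil_dec A n (a : nat -> A) : tfil n.+1 a -> tfil n a.
Proof.
case=> // H; right=> i /orP[lt|le]; apply: H; first by rewrite ltnS ltnW.
by rewrite le orbT.
Qed.

Lemma tfil_lin A n c (a b : nat -> A) : tfil n a -> tfil n b -> tfil n (c *: a + b).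
Proof.
move=> [-> _|Ha [->|Hb]]; [by left|by left|right=> i Hi].
by rewrite -[LHS]/(c *: a i + b i) Ha // Hb // scaler0 addr0.
Qed.

Lemma tfil_tconv A B C (b : A -> B -> C) i j x m :
  (forall y, b 0 y = 0) -> (forall x, b x 0 = 0) ->
  tfil i x -> tfil j m -> tfil (i + j).+1 (tconv b x m).
Proof.
move=> b0l b0r Hx Hm; right=> n.
rewrite /tconv ltnNge; have [//|nK] := leqP K n; rewrite orbF => lt /=.
apply: big1 => p _; apply: big1 => q /eqP e.
case: (ltnP p i) => [pi|ip].
  by case: Hx => [i0|Hx]; [rewrite i0 in pi|rewrite Hx ?b0l // pi].
case: Hm => [j0|Hm]; first by exfalso; lia.
by rewrite Hm ?b0r //; apply/orP; left; lia.
Qed.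

Lemma tfil_nil A n (a : nat -> A) : (K < n)%N -> tfil n a -> a = 0.
Proof.
case: n => // n; rewrite ltnS => le [//|H]; apply/funext => i; apply: H.
by apply/orP; lia.
Qed.

(** The operator t d/dt, on series whose n-th coefficient multiplies t^n for
    [euler], and t^(n+1) for [euler1]. *)
Definition euler A (a : nat -> A) : nat -> A := fun n => n%:R *: a n.
Definition euler1 A (a : nat -> A) : nat -> A := fun n => n.+1%:R *: a n.

Lemma euler_lin A : linear (@euler A).
Proof.
move=> c a b; apply/funext => n; rewrite -[RHS]/(c *: euler a n + euler b n) /euler.
by rewrite -[(_ + _) n]/(c *: a n + b n) scalerDr !scalerA mulrC.
Qed.

Lemma euler1_lin A : linear (@euler1 A).
Proof.
move=> c a b; apply/funext => n; rewrite -[RHS]/(c *: euler1 a n + euler1 b n) /euler1.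
by rewrite -[(_ + _) n]/(c *: a n + b n) scalerDr !scalerA mulrC.
Qed.

Lemma lin_Z A B (f : A -> B) : linear f -> forall k x, f (k *: x) = k *: f x.
Proof.
move=> fl k x; have f0 : f 0 = 0.
  by apply: idem0; have := fl 1 0 0; rewrite !scale1r addr0.
by have := fl k x 0; rewrite f0 !addr0.
Qed.

Section Leibniz.
Variables (A B C : lmodType F) (b : A -> B -> C).
Hypothesis bl : forall y, linear (b^~ y).
Hypothesis br : forall x, linear (b x).

Lemma euler_tconv x m : euler (tconv b x m) = tconv b (euler1 x) m + tconv b x (euler m).
Proof.
apply/funext => n; rewrite -[RHS]/(tconv b (euler1 x) m n + tconv b x (euler m) n).
rewrite /euler /tconv; case: ifP => _; last by rewrite scaler0 addr0.
rewrite scaler_sumr -big_split; apply: eq_bigr => i _ /=.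
rewrite scaler_sumr -big_split; apply: eq_bigr => j /eqP <- /=.
by rewrite /euler1 (lin_Z (bl _)) (lin_Z (br _)) -scalerDl -natrD addSn.
Qed.

Lemma euler1_tconv x m : euler1 (tconv b x m) = tconv b (euler1 x) m + tconv b x (euler1 m).
Proof.
apply/funext => n; rewrite -[RHS]/(tconv b (euler1 x) m n + tconv b x (euler1 m) n).
rewrite /euler1 /tconv; case: ifP => _; last by rewrite scaler0 addr0.
rewrite scaler_sumr -big_split; apply: eq_bigr => i _ /=.
rewrite scaler_sumr -big_split; apply: eq_bigr => j /eqP <- /=.
by rewrite (lin_Z (bl _)) (lin_Z (br _)) -scalerDl -natrD addSn addnS.
Qed.
End Leibniz.
End TruncatedProduct.

Section Series.
Variables (F : fieldType) (K : nat) (L : nlie F).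

Definition tlb := tconv K (@lb F L).

Lemma tlb_linl y : linear (tlb^~ y). Proof. exact/tconv_linl/lb_linl. Qed.
Lemma tlb_linr x : linear (tlb x). Proof. exact/tconv_linr/lb_linr. Qed.

Lemma tlb_anti x y : tlb x y = - tlb y x.
Proof.
apply/funext => n; rewrite -[RHS]/(- tlb y x n) /tlb /tconv.
case: ifP => _; last by rewrite oppr0.
under eq_bigr => i _ do rewrite big_mkcond.
rewrite exchange_big -sumrN; apply: eq_bigr => i _ /=.
rewrite -big_mkcond -sumrN; apply: eq_big => [j|j _]; first by rewrite addnC.
exact: lb_anti.
Qed.

Lemma tlb_jacobi x y z : tlb x (tlb y z) = tlb (tlb x y) z + tlb y (tlb x z).
Proof.
rewrite /tlb tconvr ?tconvl ?tconvr; do ?[exact: lb_linl|exact: lb_linr].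
rewrite [X in _ + X]tconv3_swap; apply: tconv3D => *; exact: lb_jacobi.
Qed.

Lemma lb0l (x : L) : lb 0 x = 0. Proof. exact: (@ra0l F L (adrep L)). Qed.
Lemma lb0r (x : L) : lb x 0 = 0. Proof. exact: linear0. Qed.

(** The Lie algebra t L[[t]], truncated; its element a stands for
    sum_i a_i t^(i+1). *)
Definition tlie : nlie F :=
  @NLie F (nat -> L) tlb tlb_linl tlb_linr tlb_anti tlb_jacobi (@tfil F K L)
    (fun x => or_introl erefl) (@tfil_dec F K L) (@tfil_lin F K L)
    (fun i j x y => tfil_tconv (b := @lb F L) lb0l lb0r) K.+1 (@tfil_nil F K L).

Variable M : nrep L.

Definition tra (a : tlie) : (nat -> M) -> (nat -> M) := tconv K (@ra F L M) a.

Lemma tra_linl m : linear (tra^~ m). Proof. exact/tconv_linl/ra_linl. Qed.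
Lemma tra_linr x : linear (tra x). Proof. exact/tconv_linr/ra_linr. Qed.

Lemma tra_br x y m : tra (tlb x y) m = tra x (tra y m) - tra y (tra x m).
Proof.
apply/eqP; rewrite eq_sym subr_eq; apply/eqP.
rewrite /tra /tlb tconvr ?tconvl ?tconvr; do ?[exact: ra_linl|exact: ra_linr].
rewrite [X in _ + X]tconv3_swap; apply: tconv3D => u v w.
by rewrite ra_br subrK.
Qed.

(** The module M[[t]] over t L[[t]], truncated. *)
Definition trep : nrep tlie :=
  @NRep F tlie (nat -> M) tra tra_linl tra_linr tra_br (@tfil F K M)
    (fun x => or_introl erefl) (@tfil_dec F K M) (@tfil_lin F K M)
    (fun i j x m => tfil_tconv (b := @ra F L M) (@ra0l F L M) (@ra0r F L M))
    K.+1 (@tfil_nil F K M).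

Lemma euler1_lb (x y : tlie) : euler1 (lb x y) = @lb F tlie (euler1 x) y + @lb F tlie x (euler1 y).
Proof. exact: euler1_tconv (@lb_linl F L) (@lb_linr F L) x y. Qed.

Lemma euler_ra (x : tlie) (m : trep) : euler (ra x m) = @ra F tlie trep (euler1 x) m + @ra F tlie trep x (euler m).
Proof. exact: euler_tconv (@ra_linl F L M) (@ra_linr F L M) x m. Qed.

End Series.

(** * Evaluation of noncommutative series and Dynkin's formula *)

Section WordSums.
Variable V : nmodType.

(** Sums over the words of a given length, by recursion on the first letter,
    which makes concatenation of words easy to handle. *)
Fixpoint wsum n (f : seq bool -> V) : V :=
  if n is n'.+1 then wsum n' (fun w => f (true :: w)) + wsum n' (fun w => f (false :: w))
  else f [::].

Lemma wsumE n (f : seq bool -> V) : \sum_(w : n.-tuple bool) f w = wsum n f.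
Proof.
elim: n f => [|n IH] f /=.
  by rewrite (big_pred1 [tuple]) // => w; apply/esym/eqP; exact: tuple0.
rewrite -!IH (reindex (fun p : bool * n.-tuple bool => [tuple of p.1 :: p.2])) /=; last first.
  exists (fun w : n.+1.-tuple bool => (thead w, behead_tuple w)).
    by move=> [c w] _ /=; rewrite theadE; congr pair; apply: val_inj.
  by move=> w _; rewrite [w]tuple_eta; apply: val_inj.
by rewrite -(pair_big xpredT xpredT (fun c (w : n.-tuple bool) => f (c :: w))) big_bool.
Qed.

Lemma eq_wsum n f g : (forall w, size w = n -> f w = g w) -> wsum n f = wsum n g.
Proof.
elim: n f g => [|n IH] f g fg /=; first exact: fg.
by congr (_ + _); apply: IH => w sw; apply: fg; rewrite /= sw.
Qed.

Lemma wsum0 n f : (forall w, size w = n -> f w = 0) -> wsum n f = 0.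
Proof.
move=> f0; rewrite (@eq_wsum _ _ (fun=> 0)) //; elim: n {f0} => //= n ->.
by rewrite addr0.
Qed.

Lemma wsum_cat i j f :
  wsum (i + j) f = wsum i (fun u => wsum j (fun v => f (u ++ v))).
Proof. by elim: i f => [|i IH] f //=; rewrite !IH. Qed.

Lemma wsum_sum n I (r : seq I) (f : I -> seq bool -> V) :
  wsum n (fun w => \sum_(i <- r) f i w) = \sum_(i <- r) wsum n (f i).
Proof. by elim: n f => //= n IH f; rewrite !IH big_split. Qed.

Lemma wsum_split n (f : seq bool -> seq bool -> V) :
  wsum n (fun w => \sum_(i < n.+1) f (take i w) (drop i w))
  = \sum_(i < n.+1) wsum i (fun u => wsum (n - i) (f u)).
Proof.
rewrite wsum_sum; apply: eq_bigr => i _.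
transitivity (wsum (i + (n - i)) (fun w => f (take i w) (drop i w))).
  by rewrite subnKC // -ltnS.
rewrite wsum_cat; apply: eq_wsum => u su.
by apply: eq_wsum => v _; rewrite take_size_cat // drop_size_cat.
Qed.

Lemma wsum_all n c (g : seq bool -> V) :
  wsum n (fun w => if all (pred1 c) w then g w else 0) = g (nseq n c).
Proof.
elim: n g => [|n IH] g //=; case: c IH => IH /=.
  by rewrite IH wsum0 ?addr0.
by rewrite wsum0 ?add0r ?IH.
Qed.
End WordSums.

Lemma wsum_lin (F : fieldType) (U V : lmodType F) (h : {linear U -> V}) n f :
  h (wsum n f) = wsum n (fun w => h (f w)).
Proof. by elim: n f => //= n IH f; rewrite linearD !IH. Qed.

Lemma wsumZ (F : fieldType) (V : lmodType F) (a : F) n (f : seq bool -> V) :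
  a *: wsum n f = wsum n (fun w => a *: f w).
Proof. by elim: n f => //= n IH f; rewrite scalerDr !IH. Qed.

Lemma wsumD (V : nmodType) n (f g : seq bool -> V) :
  wsum n (fun w => f w + g w) = wsum n f + wsum n g.
Proof. by elim: n f g => //= n IH f g; rewrite !IH addrACA. Qed.

Section NcSer.
Variable F : fieldType.

Lemma ncmul1 (a : ncser F) : ncmul a (nc1 F) =1 a.
Proof.
move=> w; rewrite /ncmul big_ord_recr /= take_size drop_size mulr1 big1 ?add0r // => i _.
by rewrite /nc1 -size_eq0 size_drop subn_eq0 leqNgt ltn_ord mulr0.
Qed.

(** The series e^X e^Y and e^X e^Y - 1. *)
Definition expXY : ncser F := ncmul (ncexp F true) (ncexp F false).
Definition expXY1 : ncser F := fun v => expXY v - nc1 F v.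

Lemma expXY1_nil : expXY1 [::] = 0.
Proof. by rewrite /expXY1 /expXY /ncmul big_ord1 /ncexp /= !invr1 mulr1 subrr. Qed.

Lemma ncpow_small k w : (size w < k)%N -> ncpow expXY1 k w = 0.
Proof.
elim: k w => // k IH w; rewrite ltnS => le; apply: big1 => -[[|i] lt] _ /=.
  by rewrite take0 expXY1_nil mul0r.
rewrite [X in _ * X]IH ?mulr0 // size_drop; lia.
Qed.

Lemma bch_coefE M w : (size w <= M)%N ->
  bch_coef F w = \sum_(k < M) (-1) ^+ k / k.+1%:R * ncpow expXY1 k.+1 w.
Proof.
move=> le; rewrite /bch_coef /nclog big_add1 /= big_mkord.
rewrite [RHS](@big_ord_widen0 _ (fun k : nat => (-1) ^+ k / k.+1%:R * ncpow expXY1 k.+1 w) (size w)) //.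
by move=> k le'; rewrite ncpow_small ?mulr0.
Qed.

End NcSer.

Section Eval.
Variables (F : fieldType) (charF0 : [pchar F] =i pred0) (L : nlie F) (x y : L).

Let N := (lnil L).+1.
Let letter (c : bool) := if c then x else y.

Lemma lb_xx (u : L) : lb u u = 0.
Proof.
apply/eqP; have /eqP := lb_anti u u; rewrite -addr_eq0 -mulr2n -scaler_nat.
by rewrite scaler_eq0 (negPf (natS_neq0 charF0 1)).
Qed.

(** A word acts by the composite of the operators ad of its letters. *)
Definition wact (w : seq bool) (v : L) : L := foldr (fun c => lb (letter c)) v w.

Lemma wact_lin w : linear (wact w).
Proof. by elim: w => [|c w IH] a u v //=; rewrite IH linearP. Qed.
HB.instance Definition _ w := GRing.isLinear.Build F L L *:%R (wact w) (wact_lin w).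

Lemma wact_cat u w v : wact (u ++ w) v = wact u (wact w v).
Proof. by rewrite /wact foldr_cat. Qed.

Lemma lfil_wact w j v : lfil j v -> lfil (size w + j) (wact w v).
Proof.
move=> vj; elim: w => //= c w IH.
exact: (lfil_br (lfil0 (letter c)) IH).
Qed.

Lemma wact_nil w v : (lnil L <= size w)%N -> wact w v = 0.
Proof. by move=> le; apply: lfil_nil le _; rewrite -[size w]addn0; exact/lfil_wact/lfil0. Qed.

(** A nested bracket is the adjoint action of its first letters on the nested
    bracket of the others. *)
Lemma nested_cat u w : w != [::] ->
  lnested x y (u ++ w) = wact u (lnested x y w).
Proof.
move=> w0; elim: u => //= c u IH.
by rewrite -[LHS]/(lnested x y (c :: (u ++ w))) lnestedS ?IH //; case: (u) w0.
Qed.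

(** The values of a noncommutative series a: [ev a] is the operator obtained by
    substituting ad x and ad y for the letters; [evn a] is obtained by replacing
    each word by its nested bracket. *)
Definition ev (a : ncser F) (v : L) : L :=
  \sum_(n < N) wsum n (fun w => a w *: wact w v).
Definition evn (a : ncser F) : L :=
  \sum_(n < N) wsum n (fun w => a w *: lnested x y w).

Lemma evE M a v : (N <= M)%N ->
  ev a v = \sum_(n < M) wsum n (fun w => a w *: wact w v).
Proof.
move=> le; rewrite /ev.
rewrite [RHS](@big_ord_widen0 _ (fun n => wsum n (fun w => a w *: wact w v)) N) // => n le'.
by apply: wsum0 => w sw; rewrite wact_nil ?scaler0 // sw ltnW.
Qed.

Lemma evnE M a : (N <= M)%N ->
  evn a = \sum_(n < M) wsum n (fun w => a w *: lnested x y w).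
Proof.
move=> le; rewrite /evn.
rewrite [RHS](@big_ord_widen0 _ (fun n => wsum n (fun w => a w *: lnested x y w)) N) // => n le'.
by apply: wsum0 => w sw; rewrite lnested_nil ?scaler0 // sw.
Qed.

(** Substitution is an algebra morphism. *)
Lemma ev_mul a b v : ev (ncmul a b) v = ev a (ev b v).
Proof.
rewrite (@evE (N + N)) ?leq_addr //.
pose t i j := wsum i (fun u => wsum j (fun w => (a u * b w) *: wact (u ++ w) v)).
transitivity (\sum_(n < N + N) \sum_(i < n.+1) t i (n - i)%N).
  apply: eq_bigr => n _; rewrite -wsum_split; apply: eq_wsum => w sw.
  rewrite /ncmul scaler_suml sw; apply: eq_bigr => i _.
  by rewrite cat_take_drop.
rewrite (@sum_square _ t N N) //.
- apply: eq_bigr => i _; rewrite -wsum_sum; apply: eq_wsum => u su.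
  rewrite linear_sum scaler_sumr; apply: eq_bigr => j _ /=.
  rewrite wsum_lin wsumZ; apply: eq_wsum => w _.
  by rewrite linearZ scalerA wact_cat.
- move=> i j le; apply: wsum0 => u su; apply: wsum0 => w sw.
  by rewrite wact_nil ?scaler0 // size_cat su (leq_trans (ltnW le)) ?leq_addr.
- move=> i j le; apply: wsum0 => u su; apply: wsum0 => w sw.
  by rewrite wact_nil ?scaler0 // size_cat sw (leq_trans (ltnW le)) ?leq_addl.
Qed.

(** Replacing words by nested brackets is linear over the substitution, on series
    without constant term. *)
Lemma evn_mul a b : b [::] = 0 -> evn (ncmul a b) = ev a (evn b).
Proof.
move=> b0; rewrite (@evnE (N + N)) ?leq_addr //.
pose t i j := wsum i (fun u => wsum j (fun w => (a u * b w) *: wact u (lnested x y w))).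
transitivity (\sum_(n < N + N) \sum_(i < n.+1) t i (n - i)%N).
  apply: eq_bigr => n _; rewrite -wsum_split; apply: eq_wsum => w sw.
  rewrite /ncmul scaler_suml sw; apply: eq_bigr => i _.
  case: (eqVneq (drop i w) [::]) => [->|w0]; first by rewrite b0 mulr0 !scale0r.
  by rewrite -nested_cat // cat_take_drop.
rewrite (@sum_square _ t N N) //.
- apply: eq_bigr => i _; rewrite -wsum_sum; apply: eq_wsum => u su.
  rewrite linear_sum scaler_sumr; apply: eq_bigr => j _ /=.
  rewrite wsum_lin wsumZ; apply: eq_wsum => w _.
  by rewrite linearZ scalerA.
- move=> i j le; apply: wsum0 => u su; apply: wsum0 => w sw.
  by rewrite wact_nil ?scaler0 // su ltnW.
- move=> i j le; apply: wsum0 => u su; apply: wsum0 => w sw.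
  by rewrite lnested_nil ?linear0 ?scaler0 // sw.
Qed.

Lemma evD a b v : ev (fun w => a w + b w) v = ev a v + ev b v.
Proof.
rewrite /ev -big_split; apply: eq_bigr => n _ /=.
by rewrite -wsumD; apply: eq_wsum => w _; rewrite scalerDl.
Qed.

Lemma evnD a b : evn (fun w => a w + b w) = evn a + evn b.
Proof.
rewrite /evn -big_split; apply: eq_bigr => n _ /=.
by rewrite -wsumD; apply: eq_wsum => w _; rewrite scalerDl.
Qed.

Lemma ev_ext a b v : a =1 b -> ev a v = ev b v.
Proof.
by move=> ab; apply: eq_bigr => n _; apply: eq_wsum => w _; rewrite ab.
Qed.

Lemma evn_ext a b : a =1 b -> evn a = evn b.
Proof.
by move=> ab; apply: eq_bigr => n _; apply: eq_wsum => w _; rewrite ab.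
Qed.

Lemma ev_one v : ev (nc1 F) v = v.
Proof.
rewrite /ev big_ord_recl big1 => [|n _]; first by rewrite addr0 /= scale1r.
by apply: wsum0; case=> // c w _; rewrite /nc1 /= scale0r.
Qed.

Lemma evn_one : evn (nc1 F) = 0.
Proof.
apply: big1 => n _; apply: wsum0; case=> [|c w] _; first exact: scaler0.
by rewrite /nc1 /= scale0r.
Qed.

Lemma ev_exp c v : ev (ncexp F c) v = @rexp F L (adrep L) (letter c) v.
Proof.
rewrite (@rexpE _ _ (adrep L) N) ?leqnSn //; apply: eq_bigr => n _.
rewrite -[RHS](_ : wsum n (fun w => if all (pred1 c) w then (size w)`!%:R^-1 *: wact w v else 0) = _).
  by apply: eq_wsum => w _; rewrite /ncexp; case: ifP; rewrite ?scale0r.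
rewrite wsum_all size_nseq; congr (_ *: _).
by elim: (nat_of_ord n) => //= k ->.
Qed.

Lemma evn_exp c : evn (ncexp F c) = letter c.
Proof.
rewrite (@evnE N.+1) //.
have E n : wsum n (fun w => ncexp F c w *: lnested x y w)
   = n`!%:R^-1 *: lnested x y (nseq n c).
  rewrite -[LHS](_ : wsum n (fun w => if all (pred1 c) w then (size w)`!%:R^-1 *: lnested x y w else 0) = _).
    by rewrite wsum_all size_nseq.
  by apply: eq_wsum => w _; rewrite /ncexp; case: ifP; rewrite ?scale0r.
under eq_bigr => n _ do rewrite E.
rewrite 2!big_ord_recl /= scaler0 add0r invr1 scale1r big1 ?addr0 // => n _.
rewrite /bump /=; have -> : lb (letter c) (lnested x y (nseq n.+1 c)) = 0; last by rewrite scaler0.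
elim: (nat_of_ord n) => [|k IH]; first exact: lb_xx.
by rewrite /= in IH *; rewrite IH linear0.
Qed.

Let Gop (v : L) : L := @rexp F L (adrep L) x (@rexp F L (adrep L) y v).

Lemma evA v : ev (expXY1 F) v = Gop v - v.
Proof.
have : ev (expXY F) v = ev (expXY1 F) v + v.
  by rewrite -[X in _ = _ + X](ev_one v) -evD; apply: ev_ext => w; rewrite subrK.
by rewrite ev_mul !ev_exp => /(canLR (addrK v)).
Qed.

Lemma evnA : evn (expXY1 F) = x + @rexp F L (adrep L) x y.
Proof.
have -> : evn (expXY1 F) = evn (expXY F).
  rewrite -[LHS]addr0 -evn_one -evnD; apply: evn_ext => w; by rewrite subrK.
(* [evn_mul] needs a second factor without constant term: use e^Y - 1. *)
pose B : ncser F := fun w => ncexp F false w - nc1 F w.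
have B0 : B [::] = 0 by rewrite /B /ncexp /= invr1 subrr.
have -> : evn (expXY F) = evn (ncmul (ncexp F true) B) + evn (ncexp F true).
  rewrite -evnD; apply: evn_ext => w; rewrite -(ncmul1 (ncexp F true) w) -big_split.
  by apply: eq_bigr => i _; rewrite -[RHS]mulrDr subrK.
rewrite evn_mul // !evn_exp ev_exp addrC; congr (_ + @rexp F L (adrep L) x _).
rewrite -[LHS]addr0 -evn_one -evnD -[RHS](evn_exp false).
by apply: evn_ext => w; rewrite subrK.
Qed.

Lemma evn_pow k : evn (ncpow (expXY1 F) k.+1) = iter k (fun v => Gop v - v) (x + @rexp F L (adrep L) x y).
Proof.
elim: k => [|k IH]; first by rewrite -evnA; apply: evn_ext; exact: ncmul1.
rewrite [ncpow _ _]/(ncmul (expXY1 F) (ncpow (expXY1 F) k.+1)) evn_mul ?IH ?evA //.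
by rewrite /= /ncmul big_ord1 expXY1_nil mul0r.
Qed.

(** Dynkin's formula before the division by the length of words: the nested
    brackets of log G, with G = e^X e^Y, sum up to
    sum_k (-1)^k/(k+1) (G - 1)^k w, where G acts as e^(ad x) e^(ad y) and
    w = x + e^(ad x) y is the value of G itself. *)
Lemma dynkin :
  \sum_(n < lnil L) \sum_(w : n.+1.-tuple bool) bch_coef F w *: lnested x y w
  = psio (lnil L).+1 Gop (x + @rexp F L (adrep L) x y).
Proof.
transitivity (evn (bch_coef F)).
  rewrite /evn big_ord_recl /= scaler0 add0r; apply: eq_bigr => n _.
  exact: (wsumE n.+1 (fun w => bch_coef F w *: lnested x y w)).
rewrite /psio -/N.
under [RHS]eq_bigr => k _.
  rewrite -evn_pow /evn scaler_sumr.
  under eq_bigr => n _ do rewrite wsumZ.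
  over.
rewrite exchange_big; apply: eq_bigr => n _ /=.
rewrite -wsum_sum; apply: eq_wsum => w sw.
rewrite (@bch_coefE F N) ?sw 1?ltnW // scaler_suml.
by apply: eq_bigr => k _; rewrite scalerA.
Qed.

End Eval.

(** * The differential equation of an exponential *)

Section General.
Variables (F : fieldType) (charF0 : [pchar F] =i pred0) (L : nlie F).
Implicit Types M : nrep L.

Lemma rphi_fix M x (m : M) : (0 < rnil M)%N -> ra x m = 0 -> rphi x m = m.
Proof.
rewrite /rphi /phio; case: (rnil M) => // N _ xm.
rewrite big_ord_recl /= invr1 scale1r big1 ?addr0 // => i _.
rewrite [X in _ *: X](_ : _ = 0) ?scaler0 //.
by rewrite /bump /= -iterS iterSr xm linear0.
Qed.

(** e^x y = (e^(ad x) y) e^x as operators. *)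
Lemma rexp_ra M x y (m : M) :
  rexp x (ra y m) = ra (@rexp F L (adrep L) x y) (rexp x m).
Proof.
apply: (@expo_bil F charF0 (adrep L) M M (@ra F L M) (@ra_linl F L M)
  (@ra_linr F L M) (@ra F L (adrep L) x) (@ra F L M x) (@ra F L M x)).
- by move=> u v /=; rewrite ra_br subrK.
- by move=> u; exact: (@ra_nil _ _ (adrep L)).
- by move=> u; exact: ra_nil.
- by move=> u; exact: ra_nil.
Qed.

Lemma rexpD M x (m m' : M) : rexp x (m + m') = rexp x m + rexp x m'.
Proof. exact: linearD. Qed.

Lemma rphi_lin M x : linear (@rphi F L M x).
Proof.
move=> a u v; rewrite /rphi /phio scaler_sumr -big_split; apply: eq_bigr => i _ /=.
by rewrite iter_lin scalerDr !scalerA mulrC.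
Qed.
HB.instance Definition _ M x :=
  GRing.isLinear.Build F M M *:%R (@rphi F L M x) (rphi_lin x).
End General.

(** Congruence of power series modulo t^n. *)
Definition agree (A : Type) n (u v : nat -> A) := forall i, (i < n)%N -> u i = v i.

Lemma agree_sym A n (u v : nat -> A) : agree n u v -> agree n v u.
Proof. by move=> uv i /uv. Qed.

Lemma agree_trans A n (u v w : nat -> A) : agree n u v -> agree n v w -> agree n u w.
Proof. by move=> uv vw i lt; rewrite uv ?vw. Qed.

Lemma agree_le A n k (u v : nat -> A) : (n <= k)%N -> agree k u v -> agree n u v.
Proof. by move=> le uv i lt; apply: uv; exact: leq_trans le. Qed.

Lemma agree_all A (u v : nat -> A) : (forall n, agree n u v) -> u = v.
Proof. by move=> uv; apply/funext => i; exact: (uv i.+1). Qed.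

Lemma agreeD (A : nmodType) n (u v u' v' : nat -> A) :
  agree n u v -> agree n u' v' -> agree n (u + u') (v + v').
Proof. by move=> uv uv' i lt; rewrite -[LHS]/(u i + u' i) uv ?uv'. Qed.

Lemma agreeB (A : zmodType) n (u v u' v' : nat -> A) :
  agree n u v -> agree n u' v' -> agree n (u - u') (v - v').
Proof. by move=> uv uv' i lt; rewrite -[LHS]/(u i - u' i) uv ?uv'. Qed.

Lemma agreeZ (F : fieldType) (A : lmodType F) n c (u v : nat -> A) :
  agree n u v -> agree n (c *: u) (c *: v).
Proof. by move=> uv i lt; rewrite -[LHS]/(c *: u i) uv. Qed.

Lemma agree_sum (F : fieldType) (A : lmodType F) n k (u v : nat -> nat -> A) :
  (forall i, (i < k)%N -> agree n (u i) (v i)) ->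
  agree n (\sum_(i < k) u i) (\sum_(i < k) v i).
Proof.
elim: k => [|k IH] uv; first by rewrite !big_ord0.
rewrite !big_ord_recr /=; apply: agreeD; last exact: uv.
by apply: IH => i lt; apply: uv; exact: ltnW.
Qed.

(** The series with the single coefficient a, at index k. *)
Definition tsingle (F : fieldType) (A : lmodType F) k (a : A) : nat -> A :=
  fun i => if i == k then a else 0.

Section SeriesRep.
Variables (F : fieldType) (charF0 : [pchar F] =i pred0) (L : nlie F) (K : nat).
Let T := tlie K L.
Implicit Types M : nrep L.

(** The action of t L[[t]] raises the degree by one, which gains one
    coefficient. *)
Lemma agree_ra M n (a b : T) (u v : trep K M) :
  agree n a b -> agree n u v -> agree n.+1 (ra a u : nat -> M) (ra b v).
Proof.
move=> ab uv k lt; rewrite [LHS]/(tconv _ _ _ _ k) [RHS]/(tconv _ _ _ _ k) /tconv.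
case: ifP => // _; apply: eq_bigr => i _; apply: eq_bigr => j /eqP e.
by rewrite ab ?uv //; lia.
Qed.

Lemma agree_iter M n (a b : T) (u v : trep K M) k :
  agree n a b -> agree n u v -> agree n (iter k (ra a) u : nat -> M) (iter k (ra b) v).
Proof.
move=> ab uv; elim: k => //= k IH.
exact: agree_le (leqnSn n) (agree_ra ab IH).
Qed.

Lemma agree_rexp M n (a b : T) (u v : trep K M) :
  agree n a b -> agree n u v -> agree n (rexp a u : nat -> M) (rexp b v).
Proof.
move=> ab uv; apply: (agree_sum (u := fun k => k`!%:R^-1 *: iter k (ra a) u)
  (v := fun k => k`!%:R^-1 *: iter k (ra b) v)) => k _.
exact/agreeZ/agree_iter.
Qed.

Lemma agree_rphi M n (a b : T) (u v : trep K M) :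
  agree n a b -> agree n u v -> agree n (rphi a u : nat -> M) (rphi b v).
Proof.
move=> ab uv; apply: (agree_sum (u := fun k => k.+1`!%:R^-1 *: iter k (ra a) u)
  (v := fun k => k.+1`!%:R^-1 *: iter k (ra b) v)) => k _.
exact/agreeZ/agree_iter.
Qed.

Lemma rexp_coef M (a : T) (u : trep K M) k :
  agree k (u : nat -> M) 0 -> (rexp a u : nat -> M) k = (u : nat -> M) k.
Proof.
move=> u0; apply/eqP; rewrite -subr_eq0 -[_ - _]/((rexp a u - u : nat -> M) k).
rewrite rexp_sub; apply/eqP.
have := @agree_ra M k a a (rphi a u) (rphi a 0) (fun _ _ => erefl)
  (agree_rphi (fun _ _ => erefl) u0) k (ltnSn k).
by rewrite linear0 linear0.
Qed.

Lemma euler1_br (x y : T) :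
  euler1 (lb x y) = @ra F T (adrep T) x (euler1 y) - @ra F T (adrep T) y (euler1 x).
Proof. by rewrite euler1_lb addrC [X in _ + X]lb_anti. Qed.

Lemma euler1_fil i (x : T) : lfil i x -> @rfil F T (adrep T) i (euler1 x).
Proof.
move=> [->|H]; first by left.
by right=> j /H; rewrite /euler1 => ->; rewrite scaler0.
Qed.

(** The adjoint representation extended by the derivation t d/dt: the vector
    (0, 1) stands for t d/dt itself. *)
Definition euler_rep : nrep T := @affine_rep F T (adrep T) (@euler1 F L) (@euler1_lin F L) euler1_br euler1_fil.

(** The logarithmic derivative of e^z with respect to t d/dt, that is
    (e^(ad z) - 1)/(ad z) applied to t z'. *)
Definition tlog (z : T) : T := @rphi F T (adrep T) z (euler1 z).

(** Conjugating t d/dt by e^z subtracts the logarithmic derivative of e^z. *)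
Lemma rexp_euler_rep (z : T) : @rexp F T euler_rep z (0, 1) = (- tlog z, 1).
Proof. by rewrite rexp_affine_phi linear0 scale1r sub0r. Qed.

(** t d/dt (e^z m) = e^z (t d/dt m) + tlog(z) e^z m.  The pairing
    ((a, c), m) |-> a m + c t dm/dt is invariant, so that its value at (0, 1)
    and m can be computed before or after applying e^z. *)
Lemma euler_exp M (z : T) (m : trep K M) :
  euler (rexp z m) = rexp z (euler m : trep K M) + ra (tlog z) (rexp z m).
Proof.
pose b (p : euler_rep) (v : trep K M) : trep K M := ra (p.1 : T) v + p.2 *: (euler v : trep K M).
have bl y : linear (b^~ y).
  move=> c p q; rewrite /b -[(c *: p + q).1]/(c *: p.1 + q.1).
  rewrite raDl raZl -[(c *: p + q).2]/(c * p.2 + q.2) scalerDl scalerDr scalerA.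
  by rewrite addrACA.
have br p : linear (b p).
  move=> c u v; rewrite /b linearP euler_lin scalerDr scalerDr !scalerA addrACA.
  by rewrite [c * _]mulrC.
have key := @expo_bil F charF0 euler_rep (trep K M) (trep K M) b bl br
  (@ra F T euler_rep z) (@ra F T (trep K M) z) (@ra F T (trep K M) z) _
  (rnil euler_rep) (rnil (trep K M)) (rnil (trep K M))
  (fun _ => @ra_nil _ _ euler_rep _ _ _ (leqnn _)) (fun _ => ra_nil _ _ (leqnn _))
  (fun _ => ra_nil _ _ (leqnn _)) (0, 1) m.
have : forall (p : euler_rep) v, ra z (b p v) = b (ra z p) v + b p (ra z v).
  case=> u c v.
  change (ra z (ra (u : T) v + c *: (euler v : trep K M))
    = (ra (lb z (u : T) - c *: (euler1 z : T)) v + 0 *: (euler v : trep K M))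
      + (ra (u : T) (ra z v) + c *: (euler (ra z v) : trep K M))).
  rewrite scale0r addr0 raDr raZr euler_ra raDl ra_br -scaleNr raZl scaleNr.
  rewrite scalerDr [RHS](AC (3*(1*2)) (1*(2*4)*(3*5)*6)) /=.
  by rewrite addNr addr0 addNr addr0.
move=> H; have := key H; clear H key; rewrite -[expo _ _ (b _ _)]/(rexp z _).
have -> : b (0, 1) m = euler m.
  by change (ra (0 : T) m + 1 *: (euler m : trep K M) = euler m); rewrite ra0l add0r scale1r.
rewrite -[expo _ _ (0, 1)]/(@rexp F T euler_rep z (0, 1)) rexp_euler_rep.
rewrite -[expo _ _ m]/(rexp z m) => ->.
change (euler (rexp z m) = (ra (- tlog z) (rexp z m) + 1 *: (euler (rexp z m) : trep K M))
  + ra (tlog z) (rexp z m)).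
by rewrite scale1r addrAC -raDl addNr ra0l add0r.
Qed.

Lemma euler_single (A : lmodType F) k (a : A) :
  euler (tsingle k a) = k%:R *: tsingle k a.
Proof.
apply/funext => i; rewrite -[RHS]/(k%:R *: tsingle k a i) /euler /tsingle.
by case: eqP => [->|_]; rewrite ?scaler0.
Qed.

Lemma natr_eqE j k : (j%:R == k%:R :> F) = (j == k).
Proof.
wlog le : j k / (j <= k)%N => [H|].
  by case: (leqP j k) => [/H //|/ltnW/H]; rewrite eq_sym => ->; exact: eq_sym.
by rewrite eq_sym -subr_eq0 -natrB // (proj1 (pcharf0P F) charF0) subn_eq0 eqn_leq le.
Qed.

(** Uniqueness for the differential equation t u' = k u + r u.  The coefficient of
    t^j of r u only involves lower coefficients of u, and j - k is invertible
    unless j = k, where the coefficient is an initial condition. *)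
Lemma ode_uniq M n k (r w : T) (u v : trep K M) :
  euler u = k%:R *: (u : nat -> M) + (ra r u : nat -> M) ->
  euler v = k%:R *: (v : nat -> M) + (ra w v : nat -> M) ->
  (u : nat -> M) k = (v : nat -> M) k ->
  agree n r w -> agree n.+1 (u : nat -> M) v.
Proof.
move=> Eu Ev uvk rw.
(* One coefficient at a time, from the lowest. *)
suff H j : (j <= n.+1)%N -> agree j (u : nat -> M) v by exact: (H n.+1).
elim: j => [//|j IH] lt i; rewrite ltnS leq_eqVlt => /orP[/eqP ->|]; last first.
  by apply: IH; exact: ltnW.
have [->//|jk] := eqVneq j k.
have ruv := agree_ra (agree_le (ltnSE lt) rw) (IH (ltnW lt)) (ltnSn j).
have Euj : j%:R *: (u : nat -> M) j = k%:R *: (u : nat -> M) j + (ra r u : nat -> M) j.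
  exact: (congr1 (fun f => f j) Eu).
have Evj : j%:R *: (v : nat -> M) j = k%:R *: (v : nat -> M) j + (ra w v : nat -> M) j.
  exact: (congr1 (fun f => f j) Ev).
have jk0 : (j%:R - k%:R : F) != 0.
  by rewrite subr_eq0 natr_eqE.
apply: (scalerI jk0); rewrite !scalerBl Euj Evj ruv.
by rewrite ![_%:R *: _ + _]addrC !addrK.
Qed.

Lemma agree_decomp (A : lmodType F) n (v : nat -> A) :
  agree n v (\sum_(k < n) tsingle k (v k)).
Proof.
move=> i lt; have sumE m (u : nat -> nat -> A) :
    (\sum_(k < m) u k) i = \sum_(k < m) u k i.
  elim: m => [|m IH]; first by rewrite !big_ord0.
  by rewrite !big_ord_recr /= -IH.
rewrite (sumE n (fun k => tsingle k (v k))) (bigD1 (Ordinal lt)) //= /tsingle eqxx.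
rewrite big1 ?addr0 // => j; rewrite -val_eqE /= eq_sym.
by case: eqP => // ->; rewrite eqxx.
Qed.

(** Here z is the product of t x and t y, G = e^(tx) e^(ty) and w is the
    logarithmic derivative of G.  Dynkin's formula expresses t z' by G and w. *)
Section Bch.
Variables x y : L.
Let X : T := tsingle 0 x.
Let Y : T := tsingle 0 y.
Let w : T := X + @rexp F T (adrep T) X Y.
Let z : T := lbch X Y.
Let G M (m : trep K M) : trep K M := rexp X (rexp Y m).

Lemma euler1_single (a : L) : euler1 (tsingle 0 a) = tsingle 0 a.
Proof.
apply/funext => i; rewrite /euler1 /tsingle.
by case: eqP => [->|_]; rewrite ?scale1r ?scaler0.
Qed.

Lemma tlog_single (a : L) : tlog (tsingle 0 a) = tsingle 0 a.
Proof.
rewrite /tlog euler1_single rphi_fix //.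
exact: (@lb_xx F charF0 T).
Qed.

(** G solves the differential equation with right-hand side w. *)
Lemma euler_G M (m : trep K M) : euler (G m) = G (euler m : trep K M) + (ra w (G m)).
Proof.
rewrite /G euler_exp tlog_single (euler_exp Y) tlog_single rexpD rexp_ra //.
by rewrite -addrA -raDl [_ + X]addrC.
Qed.

Lemma euler1_nested u : euler1 (lnested X Y u) = (size u)%:R *: lnested X Y u.
Proof.
elim: u => [|c u IH]; first by rewrite scale0r; apply/funext => i; rewrite /euler1 scaler0.
have Ec : euler1 (if c then X else Y) = if c then X else Y.
  by case: c; exact: euler1_single.
case: (eqVneq u [::]) => [->|u0]; first by rewrite scale1r.
rewrite lnestedS // euler1_lb Ec IH [X in _ + X]linearZ /=.
by rewrite -[X in X + _]scale1r -scalerDl -natr1 addrC.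
Qed.

(** t d/dt multiplies a nested bracket by its length, so it cancels the
    denominators of Dynkin's series. *)
Lemma euler1_bch : euler1 z = psio K.+2 (fun v : T => @rexp F T (adrep T) X (@rexp F T (adrep T) Y v)) w.
Proof.
rewrite -[RHS](dynkin charF0 X Y) /z /lbch.
pose El : {linear (nat -> L) -> (nat -> L)} :=
  HB.pack (@euler1 F L) (GRing.isLinear.Build F _ _ *:%R (@euler1 F L) (@euler1_lin F L)).
rewrite -[LHS]/(El _) linear_sum; apply: eq_bigr => n _.
rewrite linearZ linear_sum; apply: (scalerI (natS_neq0 charF0 n)).
rewrite scalerA mulfV ?natS_neq0 // scale1r scaler_sumr; apply: eq_bigr => u _.
by rewrite linearZ /= euler1_nested size_tuple !scalerA mulrC.
Qed.

Let V : nrep L := adrep L.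

(** If e^z and G agree modulo t^n, then t z' agrees with
    log(e^(ad z))/(e^(ad z) - 1) applied to w, whose image under
    (e^(ad z) - 1)/(ad z) is w. *)
Lemma step_tlog n : (forall v : trep K V, agree n (rexp z v : nat -> L) (G v)) ->
  agree n (tlog z) w.
Proof.
move=> P; rewrite /tlog euler1_bch.
(* Dynkin's formula sums up to the bound lnil T + 1 = K + 2. *)
have wE : w = @rphi F T (adrep T) z (psio K.+2 (fun v => @rexp F T (adrep T) z v) w).
  rewrite (@rphiE _ _ (adrep T) K.+2) //.
  rewrite -[LHS](@phi_psi F charF0 (adrep T) K.+2 (@ra F T (adrep T) z)).
    by congr phio; apply: eq_bigr => k _; congr (_ *: _); apply: eq_iter_fun => v;
       rewrite (@rexpE _ _ (adrep T) K.+2).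
  by move=> v; rewrite (@ra_nil _ _ (adrep T)).
rewrite {2}wE; apply: (@agree_rphi V) => //.
apply: (agree_sum (u := fun k => ((-1) ^+ k / k.+1%:R) *: iter k (fun v : T => @rexp F T (adrep T) X (@rexp F T (adrep T) Y v) - v) w)
  (v := fun k => ((-1) ^+ k / k.+1%:R) *: iter k (fun v : T => @rexp F T (adrep T) z v - v) w)) => k _.
apply: agreeZ; elim: k => //= k IH; apply: agreeB => //.
apply: agree_trans (agree_sym (P _)).
by do 2!apply: (@agree_rexp V) => //.
Qed.

Lemma G_coef M (u : trep K M) k :
  agree k (u : nat -> M) 0 -> (G u : nat -> M) k = (u : nat -> M) k.
Proof.
move=> u0; rewrite /G !rexp_coef //.
have := @agree_rexp M k Y Y u 0 (fun _ _ => erefl) u0.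
by rewrite linear0.
Qed.

Lemma exp_single M n k (a : M) : agree n (tlog z) w ->
  agree n.+1 (rexp z (tsingle k a : trep K M) : nat -> M) (G (tsingle k a : trep K M)).
Proof.
move=> P; have s0 : agree k (tsingle k a) 0.
  by move=> i lt; rewrite /tsingle ltn_eqF.
apply: (@ode_uniq _ _ k _ _ _ _ _ _ _ P).
- by rewrite euler_exp euler_single linearZ.
- by rewrite euler_G euler_single /G !linearZ.
- by rewrite rexp_coef ?G_coef.
Qed.

(** Induction on n: agreement modulo t^n gives agreement of the logarithmic
    derivatives modulo t^n, and then the differential equation gives one more
    coefficient. *)
Lemma exp_agree n (v : trep K V) : agree n (rexp z v : nat -> L) (G v).
Proof.
elim: n v => [|n IH] v; first by [].
have P := step_tlog IH.
(* The differential equation is available for series with one coefficient;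
   the others are sums of these modulo t^(n+1). *)
pose v' : trep K V := \sum_(k < n.+1) tsingle k ((v : nat -> L) k).
have vv' : agree n.+1 (v : nat -> L) v' by exact: agree_decomp.
apply: (agree_trans (@agree_rexp V n.+1 z z v v' (fun _ _ => erefl) vv')).
apply: (agree_trans _ (agree_sym (@agree_rexp V n.+1 X X _ _ (fun _ _ => erefl)
   (@agree_rexp V n.+1 Y Y v v' (fun _ _ => erefl) vv')))).
have -> : rexp z v' = \sum_(k < n.+1) rexp z (tsingle k ((v : nat -> L) k) : trep K V).
  exact: linear_sum.
have -> : rexp X (rexp Y v') = \sum_(k < n.+1) G (tsingle k ((v : nat -> L) k) : trep K V).
  by rewrite [rexp Y v']linear_sum; exact: linear_sum.
apply: (agree_sum (u := fun k => rexp z (tsingle k ((v : nat -> L) k) : trep K V))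
  (v := fun k => G (tsingle k ((v : nat -> L) k) : trep K V))) => k _.
exact: (@exp_single V).
Qed.

Lemma series_bch M (a : M) :
  rexp z (tsingle 0 a : trep K M) = G (tsingle 0 a : trep K M).
Proof.
apply: agree_all => n; apply: agree_le (leqnSn n) _; apply: exp_single.
apply: step_tlog; exact: exp_agree.
Qed.
End Bch.

End SeriesRep.

(** * The Baker-Campbell-Hausdorff product is the product of exponentials *)

Section Evaluate.
Variables (F : fieldType) (charF0 : [pchar F] =i pred0) (L : nlie F) (K : nat).
Hypotheses (K0 : (0 < K)%N) (LK : (lnil L <= K)%N).
Let T := tlie K L.

(** m is the value at t = 1 of the series u, whose i-th coefficient lies in the
    i-th step of the filtration.  This condition on u makes evaluation
    compatible with the truncated product. *)
Definition at1 (M : nrep L) (u : nat -> M) (m : M) : Prop :=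
  (forall i, rfil i (u i)) /\ \sum_(i < K) u i = m.

Lemma at1_0 M : @at1 M 0 0.
Proof. by split=> [i|]; [exact: rfil_zero|exact: big1]. Qed.

Lemma at1_lin M a u m v n : @at1 M u m -> @at1 M v n -> @at1 M (a *: u + v) (a *: m + n).
Proof.
move=> [fu <-] [fv <-]; split=> [i|]; first exact: rfil_lin.
by rewrite scaler_sumr -big_split.
Qed.

(** A product of coefficients of total degree at least K lies in a vanishing step
    of the filtration, so the truncation loses nothing at t = 1. *)
Lemma at1_ra M (a : T) x (u : trep K M) m : (rnil M <= K)%N ->
  @at1 (adrep L) a x -> @at1 M u m -> @at1 M (ra a u) (ra x m).
Proof.
move=> MK [fa <-] [fu <-]; split=> [n|].
  rewrite -[X in rfil n X]/(tconv K (@ra F L M) a u n) /tconv; case: ifP => _; last exact: rfil_zero.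
  by apply: rfil_sum => i _; apply: rfil_sum => j /eqP <-; exact: (rfil_ra (fa i) (fu j)).
rewrite ra_suml.
transitivity (\sum_(n < K) \sum_(i < K) \sum_(j < K | (i + j).+1 == n) ra (a i) (u j)).
  by apply: eq_bigr => n _; rewrite [LHS]/(tconv _ _ _ _ n) /tconv ltn_ord.
rewrite exchange_big; apply: eq_bigr => i _ /=.
rewrite (exchange_big_dep xpredT) //= linear_sum; apply: eq_bigr => j _ /=.
rewrite (eq_bigl (fun n : 'I_K => n == (i + j).+1 :> nat)); last by move=> n; rewrite eq_sym.
rewrite (big_ord1_eq _ (fun=> ra (a i) (u j))); case: ltnP => // le.
by apply/esym; apply: (@rfil_nil _ _ M (i + j).+1);
  [exact: leq_trans le | exact: (rfil_ra (fa i) (fu j))].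
Qed.

Lemma at1_bch (a b : T) x y : @at1 (adrep L) a x -> @at1 (adrep L) b y ->
  @at1 (adrep L) (lbch a b) (lbch x y).
Proof.
apply: (@lbch_rel F T L (@at1 (adrep L))); first exact: at1_0.
  by move=> *; exact: at1_lin.
by move=> *; exact: (@at1_ra (adrep L)).
Qed.

Lemma at1_exp M (a : T) x (u : trep K M) m : (rnil M <= K)%N ->
  @at1 (adrep L) a x -> @at1 M u m -> @at1 M (rexp a u) (rexp x m).
Proof.
move=> MK ax; apply: rexp_rel; first exact: at1_0.
  by move=> *; exact: at1_lin.
by move=> *; exact: at1_ra.
Qed.

Lemma at1_single (M : nrep L) (m : M) : @at1 M (tsingle 0 m) m.
Proof.
split=> [[|i]|]; [exact: rfil0|exact: rfil_zero|].
case: K K0 => // k _; rewrite big_ord_recl big1 ?addr0 //.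
Qed.

Lemma at1_inj (M : nrep L) u m n : @at1 M u m -> @at1 M u n -> m = n.
Proof. by move=> [_ <-] [_ <-]. Qed.
End Evaluate.

Section Theorems.
Variables (F : fieldType) (charF0 : [pchar F] =i pred0) (L : nlie F).

(** Evaluation at t = 1 of the same identity for t x and t y. *)
Theorem exp_bch (M : nrep L) (x y : L) (m : M) :
  rexp (lbch x y) m = rexp x (rexp y m).
Proof.
(* The successor makes K positive, so that the series t x has a coefficient. *)
pose K := (maxn (lnil L) (rnil M)).+1.
have LK : (lnil L <= K)%N by rewrite leqW // leq_maxl.
have MK : (rnil M <= K)%N by rewrite leqW // leq_maxr.
have sx := @at1_single F L K isT (adrep L) x.
have sy := @at1_single F L K isT (adrep L) y.
have sm := @at1_single F L K isT M m.
apply: at1_inj (at1_exp MK (at1_bch LK sx sy) sm) _.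
rewrite series_bch //.
exact: at1_exp MK sx (at1_exp MK sy sm).
Qed.

(** The coefficient of index n of tlog(a) is (n + 1) a_n plus an expression in
    the coefficients of smaller index. *)
Lemma tlog_inj K (a b : tlie K L) : tlog a = tlog b -> a = b.
Proof.
move=> ab; apply: agree_all => n; elim: n => [//|n IH] i.
rewrite ltnS leq_eqVlt => /orP[/eqP -> {i}|]; last exact: IH.
have EI : agree n (euler1 a) (euler1 b) by move=> i lt; rewrite /euler1 IH.
have S (c : tlie K L) : tlog c = euler1 c + \sum_(k < K) k.+2`!%:R^-1 *: iter k.+1 (@ra F _ (adrep (tlie K L)) c) (euler1 c).
  by rewrite /tlog /rphi /phio big_ord_recl /= invr1 scale1r.
have : tlog a n = tlog b n by rewrite ab.
rewrite !S -[LHS]/(euler1 a n + _ n) -[RHS]/(euler1 b n + _ n).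
have -> : (\sum_(k < K) k.+2`!%:R^-1 *: iter k.+1 (@ra F _ (adrep (tlie K L)) a) (euler1 a) : nat -> L) n
  = (\sum_(k < K) k.+2`!%:R^-1 *: iter k.+1 (@ra F _ (adrep (tlie K L)) b) (euler1 b) : nat -> L) n.
  apply: (@agree_sum _ _ n.+1 K (fun k => k.+2`!%:R^-1 *: iter k.+1 (@ra F _ (adrep (tlie K L)) a) (euler1 a))
    (fun k => k.+2`!%:R^-1 *: iter k.+1 (@ra F _ (adrep (tlie K L)) b) (euler1 b))) => // k _.
  apply: agreeZ; apply: (@agree_ra F L K (adrep L)) => //.
  exact: (@agree_iter F L K (adrep L)).
by move=> /addIr; rewrite /euler1 => /(scalerI (natS_neq0 charF0 n)).
Qed.

Lemma tbch_inj K (a b : tlie K L) :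
  @rexp F _ (euler_rep L K) a (0, 1) = @rexp F _ (euler_rep L K) b (0, 1) -> a = b.
Proof. by rewrite !rexp_euler_rep => -[/oppr_inj ab]; exact: tlog_inj. Qed.
End Theorems.

Section Assoc.
Variables (F : fieldType) (charF0 : [pchar F] =i pred0) (L : nlie F).

(** The adjoint action determines the product only up to the centre of L.  Over
    t L[[t]] the extension by t d/dt is faithful enough: there both sides send
    t d/dt to the same element by [exp_bch].  Then put t = 1. *)
Theorem lbchA (x y z : L) : lbch (lbch x y) z = lbch x (lbch y z).
Proof.
pose K := (lnil L).+1; have LK : (lnil L <= K)%N by [].
have sx := @at1_single F L K isT (adrep L) x.
have sy := @at1_single F L K isT (adrep L) y.
have sz := @at1_single F L K isT (adrep L) z.
apply: at1_inj (at1_bch LK (at1_bch LK sx sy) sz) _.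
have -> : lbch (lbch (tsingle 0 x : tlie K L) (tsingle 0 y)) (tsingle 0 z)
    = lbch (tsingle 0 x : tlie K L) (lbch (tsingle 0 y : tlie K L) (tsingle 0 z)).
  by apply: (tbch_inj charF0); rewrite !(@exp_bch F charF0 (tlie K L) (euler_rep L K)).
exact: (at1_bch LK sx (at1_bch LK sy sz)).
Qed.

Lemma bch_coef_letter c : bch_coef F [:: c] = 1.
Proof.
rewrite (@bch_coefE F 1) // big_ord1 expr0 divr1 mul1r.
rewrite [LHS]ncmul1 /expXY1 /expXY /ncmul 2!big_ord_recl big_ord0 /nc1 /ncexp /=.
by case: c; rewrite /= ?invr1 ?mulr1 ?mul1r ?mulr0 ?mul0r ?addr0 ?add0r ?subr0.
Qed.

(** All nested brackets of length at least two vanish. *)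
Lemma lbch_comm (x y : L) : lb x y = 0 -> lbch x y = x + y.
Proof.
move=> xy0; rewrite (@lbchE F L (lnil L).+1) // big_ord_recl [X in _ + X]big1 ?addr0.
  rewrite invr1 scale1r [LHS](wsumE 1 (fun w => bch_coef F w *: lnested x y w)) /=.
  by rewrite !bch_coef_letter !scale1r.
move=> n _; rewrite lift0.
rewrite [X in _ *: X](wsumE n.+2 (fun w => bch_coef F w *: lnested x y w)) wsum0 ?scaler0 // => w.
move=> sw; suff -> : lnested x y w = 0 by rewrite scaler0.
case: w sw => [//|c w] [sw]; rewrite lnestedS; last by rewrite -size_eq0 sw.
elim: w c (nat_of_ord n) sw => // c' w IH c k [sw].
case: (eqVneq w [::]) => [->|w0].
  case: c c' => [] [] /=; rewrite ?xy0 ?lb_xx //.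
  by rewrite lb_anti xy0 oppr0.
rewrite lnestedS //; case: k sw => [|k] sw; first by rewrite -size_eq0 sw in w0.
by rewrite (IH _ k) // linear0.
Qed.
End Assoc.

(** * Nilpotent dglas *)

HB.instance Definition _ (F : fieldType) (L M : dgla F) (f : dgmap L M) n :=
  GRing.isLinear.Build F (L n) (M n) *:%R (@mf F L M f n) (@mf_lin F L M f n).

Section Lcs.
Variables (F : fieldType) (D : dgla F).

Lemma lcs_zero n i : lcs n (0 : D i).
Proof.
elim: n => [|n IH]; first exact: Lcs0.
by have := LcsBr (add0r i) 0 IH; rewrite br0l.
Qed.

Lemma lcsZ n i a (x : D i) : lcs n x -> lcs n (a *: x).
Proof. by move=> nx; rewrite -[_ *: _]addr0; apply: LcsLin => //; exact: lcs_zero. Qed.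

Lemma lcsD n i (x y : D i) : lcs n x -> lcs n y -> lcs n (x + y).
Proof. by move=> nx; rewrite -[x in x + _]scale1r; exact: LcsLin. Qed.

Lemma lcs_sum n i I (r : seq I) (P : pred I) (x : I -> D i) :
  (forall j, P j -> lcs n (x j)) -> lcs n (\sum_(j <- r | P j) x j).
Proof.
move=> H; apply: big_ind => //; first exact: lcs_zero.
by move=> *; exact: lcsD.
Qed.

Lemma lcs_pred n i (x : D i) : lcs n x -> lcs n.-1 x.
Proof.
move=> H; induction H as [i x|n i j k p x y _ IH|n i a x y _ IHx _ IHy].
- exact: Lcs0.
- by case: n IH => [|n] IH; [exact: Lcs0|exact: LcsBr].
- exact: LcsLin.
Qed.

Lemma lcs_le n m i (x : D i) : (n <= m)%N -> lcs m x -> lcs n x.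
Proof. by move=> /subnK <-; elim: (m - n)%N => // k IH /lcs_pred. Qed.

(** The lower central series is compatible with brackets, by the Jacobi
    identity. *)
Lemma lcs_br n i (x : D i) : lcs n x -> forall m j (y : D j), lcs m y ->
  forall k (p : i + j = k), lcs (n + m).+1 (br p x y).
Proof.
move=> H; induction H as [i x|n a b c q x y' _ IH|n i a x x' _ IHx _ IHy];
  move=> m j y ym k p.
- exact: LcsBr.
- have P : a + (b + j) = k by rewrite addrA q.
  have R : b + (a + j) = k by rewrite addrCA.
  have J := br_jacobi q (erefl (b + j)) (erefl (a + j)) P p R x y' y.
  rewrite -[br p _ _](addrK ((-1) ^ (a * b) *: br R y' (br (erefl (a + j)) x y))) -J.
  apply: lcsD; first by apply: LcsBr; exact: IH.
  rewrite -scaleNr; apply: lcsZ; rewrite addSn -addnS; apply: IH.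
  exact: LcsBr.
- by rewrite brDl brZl; apply: LcsLin; [exact: IHx|exact: IHy].
Qed.

Lemma lcs_df n i (x : D i) : lcs n x -> forall j (p : i + 1 = j), lcs n (df p x).
Proof.
move=> H; induction H as [i x|n a b c q x y ny IH|n i a x x' _ IHx _ IHy] => l p.
- exact: Lcs0.
- have q' : (a + 1) + b = l by rewrite addrAC q.
  have r' : a + (b + 1) = l by rewrite addrA q.
  rewrite (df_leibniz q (erefl (a + 1)) (erefl (b + 1)) p q' r').
  by apply: lcsD; [exact: LcsBr|apply: lcsZ; apply: LcsBr; exact: IH].
- by rewrite dfD dfZ; apply: LcsLin; [exact: IHx|exact: IHy].
Qed.
End Lcs.

Section Component.
Variables (F : fieldType) (charF0 : [pchar F] =i pred0).
Variables (D : dgla F) (Dn : nilpotent D).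

Let nil := sval (cid Dn).

Lemma lcs_nil m i (x : D i) : (nil <= m)%N -> lcs m x -> x = 0.
Proof. by move=> le xm; apply: (svalP (cid Dn)); exact: lcs_le xm. Qed.

Lemma br00_anti (x y : D 0) : br (add0r 0) x y = - br (add0r 0) y x.
Proof. by rewrite (br_anti _ (add0r 0)) mul0r expr0z scale1r. Qed.

Lemma br_jac0 n m k (p : n + m = k) (x : D 0) (y : D n) (z : D m) :
  br (add0r k) x (br p y z) = br p (br (add0r n) x y) z + br p y (br (add0r m) x z).
Proof.
by rewrite (br_jacobi (add0r n) p (add0r m) (add0r k) p p) mul0r expr0z scale1r.
Qed.

Definition dlie : nlie F :=
  @NLie F (D 0) (fun x y => br (add0r 0) x y) (br_linl (add0r 0)) (br_linr (add0r 0))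
    br00_anti (br_jac0 (add0r 0)) (fun n => @lcs F D n 0) (@Lcs0 F D 0)
    (fun n x => @lcs_pred F D n.+1 0 x) (fun n a x y => @LcsLin F D n 0 a x y)
    (fun i j x y xi yj => lcs_br xi yj (add0r 0)) nil (fun n x => @lcs_nil n 0 x).

Lemma drep_br n (x y : dlie) (m : D n) : br (add0r n) (lb x y : D 0) m
  = br (add0r n) (x : D 0) (br (add0r n) (y : D 0) m)
    - br (add0r n) (y : D 0) (br (add0r n) (x : D 0) m).
Proof. by rewrite br_jac0 addrK. Qed.

Definition drep n : nrep dlie :=
  @NRep F dlie (D n) (fun x m => br (add0r n) (x : D 0) m) (br_linl (add0r n))
   (br_linr (add0r n)) (@drep_br n) (fun k => @lcs F D k n) (@Lcs0 F D n)
   (fun k x => @lcs_pred F D k.+1 n x) (fun k a x y => @LcsLin F D k n a x y)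
   (fun i j x y xi yj => lcs_br xi yj (add0r n)) nil (fun k x => @lcs_nil k n x).

Definition diff01 (x : D 0) : D 1 := df (erefl : 0 + 1 = 1 :> int) x.

Lemma diff01_br (x y : dlie) : diff01 (lb x y) =
  @ra F dlie (drep 1) x (diff01 y) - @ra F dlie (drep 1) y (diff01 x).
Proof.
rewrite /diff01 (df_leibniz (add0r 0) (erefl : 0 + 1 = 1 :> int)
  (erefl : 0 + 1 = 1 :> int) erefl (addr0 1) (add0r 1)) expr0z scale1r addrC.
by congr (_ + _); rewrite (br_anti _ (add0r 1)) mulr0 expr0z scale1r.
Qed.

(** The affine action of degree 0 on degree 1 whose exponential is the gauge
    action; a pair (m, c) stands for m + c d. *)
Definition gauge_rep : nrep dlie := @affine_rep F dlie (drep 1) diff01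
  (df_lin (erefl : 0 + 1 = 1 :> int)) diff01_br (fun i x xi => lcs_df xi erefl).

Lemma rexp_gauge_rep (y : dlie) (m : D 1) : @rexp F dlie gauge_rep y (m, 1) =
  (m + \sum_(k < nil) k.+1`!%:R^-1 *:
     iter k (@ra F dlie (drep 1) y) (@ra F dlie (drep 1) y m - diff01 y), 1).
Proof. by rewrite rexp_affine scale1r. Qed.

(** The bracket of u + c d and v + e d, where d has square zero. *)
Definition curv2 (p q : gauge_rep) : drep 2 :=
  br (erefl : 1 + 1 = 2 :> int) (p.1 : D 1) (q.1 : D 1)
  + (p.2 *: df (erefl : 1 + 1 = 2 :> int) (q.1 : D 1)
     + q.2 *: df (erefl : 1 + 1 = 2 :> int) (p.1 : D 1)).

Lemma curv2_linl q : linear (curv2^~ q).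
Proof.
move=> a p p'; rewrite /curv2 /= brDl brZl dfD dfZ scalerDl !scalerDr !scalerA.
by rewrite [q.2 * a]mulrC [LHS](AC (2*(2*2)) ((1*3*5)*(2*4*6))) /= !addrA.
Qed.

Lemma curv2_linr p : linear (curv2 p).
Proof.
move=> a q q'; rewrite /curv2 /= brDr brZr dfD dfZ scalerDl !scalerDr !scalerA.
by rewrite [p.2 * a]mulrC [LHS](AC (2*(2*2)) ((1*3*5)*(2*4*6))) /= !addrA.
Qed.

Lemma curv2_act (y : dlie) p q :
  ra y (curv2 p q) = curv2 (ra y p) q + curv2 p (ra y q).
Proof.
case: p q => [u c] [v e]; pose e2 := erefl : 1 + 1 = 2 :> int.
change (br (add0r 2) (y : D 0) (br e2 u v + ((c : F) *: df e2 v + (e : F) *: df e2 u))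
  = (br e2 (br (add0r 1) (y : D 0) u - (c : F) *: diff01 y) v
     + ((0 : F) *: df e2 v
        + (e : F) *: df e2 (br (add0r 1) (y : D 0) u - (c : F) *: diff01 y)))
  + (br e2 u (br (add0r 1) (y : D 0) v - (e : F) *: diff01 y)
     + ((c : F) *: df e2 (br (add0r 1) (y : D 0) v - (e : F) *: diff01 y)
        + (0 : F) *: df e2 u))).
have dbr w : df e2 (br (add0r 1) (y : D 0) w)
    = br e2 (diff01 y) w + br (add0r 2) (y : D 0) (df e2 w).
  by rewrite (df_leibniz _ (erefl : 0 + 1 = 1 :> int) e2 _ e2 (add0r 2)) expr0z scale1r.
have dd : df e2 (diff01 y) = 0 by rewrite /diff01 df_df.
have sym : br e2 u (diff01 y) = br e2 (diff01 y) u.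
  by rewrite (br_anti _ e2) mulr1 expr1z scaleN1r opprK.
rewrite !scale0r addr0 add0r -!scaleNr.
rewrite [in RHS]brDl [in RHS]brDr brZl brZr !dfD !dfZ dd !scaler0 !addr0 !dbr sym.
rewrite !brDr !brZr br_jac0 !scalerDr.
rewrite [RHS](AC ((2*2)*(2*2)) (((1*5)*(8*4))*((2*7)*(3*6)))) /=.
by rewrite !scaleNr addNr addrN !addr0.
Qed.

Lemma exp_curv2 (y : dlie) p q :
  @rexp F dlie (drep 2) y (curv2 p q)
  = curv2 (@rexp F dlie gauge_rep y p) (@rexp F dlie gauge_rep y q).
Proof.
apply: (@expo_bil F charF0 gauge_rep gauge_rep (drep 2) curv2 curv2_linl curv2_linr
  (@ra F dlie gauge_rep y) (@ra F dlie gauge_rep y) (@ra F dlie (drep 2) y) (curv2_act y)).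
- by move=> u; exact: (@ra_nil _ _ gauge_rep).
- by move=> u; exact: (@ra_nil _ _ gauge_rep).
- by move=> u; exact: (@ra_nil _ _ (drep 2)).
Qed.

Lemma curv2_diag (m : D 1) : curv2 (m, 1) (m, 1) = 2%:R *: mc_curv m.
Proof.
rewrite /curv2 /mc_curv /= !scale1r scalerDr scalerA mulfV ?natS_neq0 // scale1r.
by rewrite addrC scaler_nat (mulr2n (df _ m)).
Qed.

End Component.

(** * Pronilpotent dglas *)

Section Psum.
Variables (F : fieldType) (g : pronil F).

Lemma pr_inj n (x y : g n) : (forall i, pr i n x = pr i n y) -> x = y.
Proof.
move=> xy; have [z [_ uniq]] := @pr_limit F g n (fun i => pr i n x)
  (fun i j p => pr_compat p x).
by rewrite -(uniq x) ?(uniq y).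
Qed.

(** Convergence criterion: in each component almost all terms vanish. *)
Definition pconv n (t : nat -> g n) : Prop :=
  forall i, exists N, forall k, (N <= k)%N -> pr i n (t k) = 0.

Lemma is_psum_uniq n (t : nat -> g n) s s' : is_psum t s -> is_psum t s' -> s = s'.
Proof.
move=> ts ts'; apply: pr_inj => i.
have [N HN] := ts i; have [N' HN'] := ts' i.
by rewrite -(HN (maxn N N')) ?leq_maxl // HN' ?leq_maxr.
Qed.

Lemma psum_eq n (t : nat -> g n) s : is_psum t s -> psum t = s.
Proof.
by move=> ts; apply: is_psum_uniq (ts); exact: (@xgetI _ 0 [set s | is_psum t s] s ts).
Qed.

Lemma pr_sum n N (t : nat -> g n) i :
  pr i n (\sum_(k < N) t k) = \sum_(k < N) pr i n (t k).
Proof. exact: linear_sum. Qed.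

(** The eventual values of the partial sums form a compatible family. *)
Lemma psumP n (t : nat -> g n) : pconv t -> is_psum t (psum t).
Proof.
move=> tc; suff [s ts] : exists s, is_psum t s by rewrite (psum_eq ts).
pose N i := sval (cid (tc i)).
have NP i k : (N i <= k)%N -> pr i n (t k) = 0 by exact: svalP (cid (tc i)) k.
pose s i : psys g i n := \sum_(k < N i) pr i n (t k).
have sE i M : (N i <= M)%N -> \sum_(k < M) pr i n (t k) = s i.
  by move=> le; apply: (big_ord_widen0 (t := fun k => pr i n (t k))) => // k; exact: NP.
have [i j p|x [xs _]] := @pr_limit F g n s.
  rewrite -(sE i (maxn (N i) (N j))) ?leq_maxl // -(sE j (maxn (N i) (N j))) ?leq_maxr //.
  by rewrite linear_sum; apply: eq_bigr => k _; exact: pr_compat.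
by exists x => i; exists (N i) => m le; rewrite pr_sum xs sE.
Qed.

Lemma pr_psum n (t : nat -> g n) i N : pconv t ->
  (forall k, (N <= k)%N -> pr i n (t k) = 0) ->
  pr i n (psum t) = \sum_(k < N) pr i n (t k).
Proof.
move=> /psumP/(_ i)[M HM] t0.
rewrite -(HM (maxn M N)) ?leq_maxl // pr_sum.
by rewrite (@big_ord_widen0 _ (fun k => pr i n (t k)) N) ?leq_maxr.
Qed.

Lemma psumD n (t t' : nat -> g n) : pconv t -> pconv t' ->
  psum (fun k => t k + t' k) = psum t + psum t'.
Proof.
move=> tc tc'; apply: psum_eq => i.
have [N HN] := psumP tc i; have [N' HN'] := psumP tc' i.
exists (maxn N N') => m le; rewrite big_split /= linearD /=.
by rewrite HN ?HN' ?linearD // (leq_trans _ le) ?leq_maxl ?leq_maxr.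
Qed.

Lemma psum_df n m (p : n + 1 = m) (t : nat -> g n) : pconv t ->
  psum (fun k => df p (t k)) = df p (psum t).
Proof.
move=> tc; apply: psum_eq => i; have [N HN] := psumP tc i.
exists N => k le; rewrite mf_df -(HN k le) -mf_df; congr (pr i _ _).
elim: (k) => [|j IH]; first by rewrite !big_ord0 df0.
by rewrite !big_ord_recr /= dfD IH.
Qed.
End Psum.

Section Bch.
Variables (F : fieldType) (charF0 : [pchar F] =i pred0) (g : pronil F).
Let S := psys g.
Let L i := dlie (@obj_nilpotent F S i).

Lemma pr_nested i (x y : g 0) w :
  pr i 0 (nested_br x y w) = lnested (pr i 0 x : L i) (pr i 0 y) w.
Proof.
elim: w => [|c w IH]; first exact: mf_0.
case: (eqVneq w [::]) => [->|w0]; first by case: c.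
rewrite lnestedS // -IH; case: w w0 {IH} => // c' w _.
by rewrite [LHS]mf_br; case: c.
Qed.

Lemma lcs_nested i (x y : g 0) w : lcs (size w).-1 (pr i 0 (nested_br x y w)).
Proof. rewrite pr_nested; exact: (@lfil_nested F (L i)). Qed.

(** The terms of the series below lie deeper and deeper in the lower central
    series, which is eventually zero in each component. *)
Lemma pconv_lcs n (t : nat -> g n) : (forall i k, lcs k (pr i n (t k))) -> pconv t.
Proof.
move=> H i; have [N HN] := obj_nilpotent i; exists N => k le.
by apply: HN; apply: lcs_le le _.
Qed.

Let bchterm (x y : g 0) n := (n.+1)%:R^-1 *:
    \sum_(w : n.+1.-tuple bool) bch_coef F w *: nested_br x y w.

Lemma pconv_bch (x y : g 0) : pconv (bchterm x y).
Proof.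
apply: pconv_lcs => i k; rewrite /bchterm mf_Z linear_sum; apply: lcsZ.
apply: lcs_sum => w _; rewrite /= mf_Z; apply: lcsZ.
by have := lcs_nested i x y w; rewrite size_tuple.
Qed.

Lemma pr_bch i (x y : g 0) : pr i 0 (bch x y) = lbch (pr i 0 x : L i) (pr i 0 y).
Proof.
have E k : pr i 0 (bchterm x y k) = (k.+1)%:R^-1 *:
    \sum_(w : k.+1.-tuple bool) bch_coef F w *: lnested (pr i 0 x : L i) (pr i 0 y) w.
  rewrite mf_Z linear_sum; congr (_ *: _); apply: eq_bigr => w _.
  by rewrite /= mf_Z pr_nested.
rewrite (@pr_psum _ _ _ _ i (lnil (L i))); first by apply: eq_bigr => k _; exact: E.
  exact: pconv_bch.
move=> k le; rewrite E big1 ?scaler0 // => w _.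
by rewrite lnested_nil ?scaler0 // size_tuple.
Qed.

Lemma bchA (x y z : g 0) : bch (bch x y) z = bch x (bch y z).
Proof. by apply: pr_inj => i; rewrite !pr_bch lbchA. Qed.

Lemma bch_comm (x y : g 0) : br (add0r 0) x y = 0 -> bch x y = x + y.
Proof.
move=> xy; apply: pr_inj => i; rewrite pr_bch mf_D; apply: (@lbch_comm F charF0 (L i)).
by rewrite [LHS](esym (mf_br _ _ _ _)) xy mf_0.
Qed.

Lemma bchx0 (x : g 0) : bch x 0 = x.
Proof. by rewrite bch_comm ?addr0 // br0r. Qed.
Lemma bch0x (x : g 0) : bch 0 x = x.
Proof. by rewrite bch_comm ?add0r // br0l. Qed.

Lemma br00_xx (x : g 0) : br (add0r 0) x x = 0.
Proof.
apply/eqP; have /eqP := br00_anti x x; rewrite -addr_eq0 -mulr2n -scaler_nat.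
by rewrite scaler_eq0 (negPf (natS_neq0 charF0 1)).
Qed.

Lemma bchxN (x : g 0) : bch x (- x) = 0.
Proof. by rewrite bch_comm ?subrr // -scaleN1r brZr br00_xx scaler0. Qed.
Lemma bchNx (x : g 0) : bch (- x) x = 0.
Proof. by rewrite -[x in bch _ x]opprK bchxN. Qed.

Let R i := gauge_rep (@obj_nilpotent F S i).

Lemma pconv_gauge (y : g 0) (v : g 1) :
  pconv (fun n => (n.+1)`!%:R^-1 *: iter n (ad0 y) v).
Proof.
apply: pconv_lcs => i k; rewrite mf_Z; apply: lcsZ.
elim: k => [|k IH]; first exact: Lcs0.
by rewrite /= [pr _ _ _]mf_br; exact: LcsBr.
Qed.

Lemma pr_gauge i (y : g 0) (xi : g 1) :
  (pr i 1 (gauge y xi), 1) = @rexp F (L i) (R i) (pr i 0 y) (pr i 1 xi, 1).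
Proof.
rewrite rexp_gauge_rep; congr (_, _); rewrite /gauge mf_D; congr (_ + _).
have E k : pr i 1 (k.+1`!%:R^-1 *: iter k (ad0 y)
      (ad0 y xi - df (erefl : 0 + 1 = 1 :> int) y))
    = k.+1`!%:R^-1 *: iter k (@ra F (L i) (drep _ 1) (pr i 0 y))
      (@ra F (L i) (drep _ 1) (pr i 0 y) (pr i 1 xi) - diff01 (pr i 0 y)).
  rewrite mf_Z; congr (_ *: _); elim: k => [|k IH].
    by rewrite /= linearB /= [pr i 1 (ad0 _ _)]mf_br mf_df.
  by rewrite /= [LHS]mf_br IH.
rewrite (@pr_psum _ _ _ _ i (rnil (drep (@obj_nilpotent F S i) 1))).
- by apply: eq_bigr => k _; exact: E.
- exact: pconv_gauge.
- by move=> k le; rewrite E (@ra_nil _ _ (drep _ 1)) ?scaler0.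
Qed.

(** The gauge action is an action, since in each component it is an
    exponential. *)
Lemma gauge_bch (x y : g 0) (xi : g 1) : gauge (bch x y) xi = gauge x (gauge y xi).
Proof.
apply: pr_inj => i.
have : (pr i 1 (gauge (bch x y) xi), 1 : F^o) = (pr i 1 (gauge x (gauge y xi)), 1).
  by rewrite !pr_gauge pr_bch exp_bch.
by case.
Qed.

(** (e^y - 1)/y is invertible, so e^y fixes xi exactly when the infinitesimal
    action of y on xi vanishes. *)
Lemma gauge_fix (y : g 0) (xi : g 1) :
  ad0 y xi - df (erefl : 0 + 1 = 1 :> int) y = 0 <-> gauge y xi = xi.
Proof.
split=> [v0|fixed].
  rewrite /gauge v0 (@psum_eq _ _ _ _ 0) ?addr0 // => i; exists 0 => m _.
  congr (pr i _ _); apply: big1 => k _; rewrite [iter _ _ _](_ : _ = 0) ?scaler0 //.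
  by elim: (nat_of_ord k) => //= j ->; rewrite /ad0 br0r.
apply: pr_inj => i; rewrite mf_0 linearB /= [pr i 1 (ad0 _ _)]mf_br mf_df.
have := pr_gauge i y xi; rewrite fixed rexp_gauge_rep => -[/esym/eqP].
rewrite -subr_eq0 addrC addKr => /eqP phi0.
have := @psi_phi F charF0 _ _ (@ra F (L i) (drep (@obj_nilpotent F S i) 1) (pr i 0 y))
  (fun m => ra_nil _ m (leqnn _)) (br (add0r 1) (pr i 0 y) (pr i 1 xi) - diff01 (pr i 0 y)).
rewrite /phio phi0 => <-; rewrite /psio big1 // => k _.
rewrite [iter _ _ _](_ : _ = 0) ?scaler0 //.
elim: (nat_of_ord k) => //= j ->; rewrite subr0.
exact: (linear0 (@rexp F (L i) (drep (@obj_nilpotent F S i) 1) (pr i 0 y))).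
Qed.

Lemma gauge0 (xi : g 1) : gauge 0 xi = xi.
Proof. by apply/gauge_fix; rewrite /ad0 br0l df0 subr0. Qed.

Lemma gaugeNK (y : g 0) (xi : g 1) : gauge (- y) (gauge y xi) = xi.
Proof. by rewrite -gauge_bch bchNx gauge0. Qed.
(** The curvature is half the value of the invariant pairing [curv2] at
    (xi, 1), (xi, 1), so e^y takes the curvature of xi to that of its
    transform. *)
Lemma gauge_mc (y : g 0) (xi : g 1) : mc_curv xi = 0 -> mc_curv (gauge y xi) = 0.
Proof.
move=> mc; have mcpr i (m : g 1) : pr i 2 (mc_curv m) = mc_curv (pr i 1 m).
  by rewrite /mc_curv mf_D mf_Z mf_df mf_br.
apply: pr_inj => i; rewrite mf_0 mcpr; apply: (scalerI (natS_neq0 charF0 1)).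
rewrite -(@curv2_diag F charF0 _ (@obj_nilpotent F S i)) pr_gauge -exp_curv2 //.
by rewrite curv2_diag // -mcpr mc mf_0 scaler0 [LHS]linear0.
Qed.

Lemma gauge_mc_eq0 (y : g 0) (x : MC g) : mc_curv (gauge y (val x)) == 0.
Proof. by apply/eqP; apply: gauge_mc; exact/eqP/(valP x). Qed.

Definition mc_gauge (y : g 0) (x : MC g) : MC g :=
  exist _ (gauge y (val x)) (gauge_mc_eq0 y x).

End Bch.

(** * Continuous maps, cycles and boundaries *)

Section Maps.
Variables (F : fieldType) (g h : pronil F) (f : pdgmap g h).

(** By continuity, each component of the image is controlled by one component of
    the source. *)
Lemma map_psum n (t : nat -> g n) : pconv t ->
  f n (psum t) = psum (fun k => f n (t k)).
Proof.
move=> tc; apply/esym/psum_eq => j; have [i fi] := pmf_cont f n j.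
have [N HN] := psumP tc i; exists N => m le.
apply/eqP; rewrite -subr_eq0 -linear_sum -linearB -linearB /=; apply/eqP/fi.
by rewrite linearB /= HN // subrr.
Qed.

Lemma map_nested (x y : g 0) w : f 0 (nested_br x y w) = nested_br (f 0 x) (f 0 y) w.
Proof.
elim: w => [|c w IH]; first exact: mf_0.
case: w IH => [_|c' w IH]; first by case: c.
by rewrite [LHS]mf_br IH; case: c.
Qed.

Lemma map_bch (x y : g 0) : f 0 (bch x y) = bch (f 0 x) (f 0 y).
Proof.
rewrite /bch map_psum; last exact: pconv_bch.
congr psum; apply/funext => n; rewrite linearZ linear_sum; congr (_ *: _).
by apply: eq_bigr => w _; rewrite linearZ /= map_nested.
Qed.

Lemma map_gauge (y : g 0) (xi : g 1) : f 1 (gauge y xi) = gauge (f 0 y) (f 1 xi).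
Proof.
rewrite /gauge linearD /= map_psum; last exact: pconv_gauge.
congr (_ + psum _); apply/funext => n; rewrite linearZ /=; congr (_ *: _).
elim: n => [|n IH]; last by rewrite /= [LHS]mf_br IH.
by rewrite /= linearB /= [f 1 (ad0 _ _)]mf_br mf_df.
Qed.
End Maps.

Section Cycles.
Variables (F : fieldType) (p : pronil F).
Let d0 : p 0 -> p 1 := df (erefl : 0 + 1 = 1 :> int).
Let dm1 : p (-1) -> p 0 := df (erefl : -1 + 1 = 0 :> int).

Lemma cycle_br (x y : p 0) : d0 x = 0 -> d0 y = 0 -> d0 (br (add0r 0) x y) = 0.
Proof.
move=> dx dy; rewrite /d0 (df_leibniz (add0r 0) (erefl : 0 + 1 = 1 :> int)
  (erefl : 0 + 1 = 1 :> int) erefl (addr0 1) (add0r 1)) -!/(d0 _) dx dy.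
by rewrite br0l br0r scaler0 addr0.
Qed.

Lemma cycle_nested (x y : p 0) w : d0 x = 0 -> d0 y = 0 -> d0 (nested_br x y w) = 0.
Proof.
move=> dx dy; elim: w => [|c w IH]; first exact: df0.
case: w IH => [_|c' w IH]; first by case: c.
by apply: cycle_br => //; case: c.
Qed.

Lemma df_sum i j (q : i + 1 = j) I (r : seq I) (P : pred I) (x : I -> p i) :
  df q (\sum_(k <- r | P k) x k) = \sum_(k <- r | P k) df q (x k).
Proof. by apply: (big_morph (df q)) => [a b|]; [exact: dfD|exact: df0]. Qed.

Lemma cycle_bch (x y : p 0) : d0 x = 0 -> d0 y = 0 -> d0 (bch x y) = 0.
Proof.
move=> dx dy; rewrite /d0 /bch -psum_df; last exact: pconv_bch.
apply: psum_eq => i; exists 0 => m _; congr (pr i _ _); apply: big1 => k _.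
rewrite dfZ df_sum big1 ?scaler0 // => w _.
by rewrite dfZ [X in _ *: X]cycle_nested // scaler0.
Qed.

Section Boundary.
Variables (x y : p 0) (u v : p (-1)).
Hypotheses (dx : d0 x = 0) (dy : d0 y = 0).
Let x' := x + dm1 u.
Let y' := y + dm1 v.

(** For a cycle n' = n + d q, one has
    [x + d u, n'] - [x, n] = d ([x, q] + [u, n']). *)
Fixpoint nested_prim (w : seq bool) : p (-1) :=
  match w with
  | [::] => 0
  | [:: c] => if c then u else v
  | c :: w' => br (add0r (-1)) (if c then x else y) (nested_prim w')
               + br (addr0 (-1)) (if c then u else v) (nested_br x' y' w')
  end.

Lemma nested_primP w : nested_br x' y' w = nested_br x y w + dm1 (nested_prim w).
Proof.
have dd z : d0 (dm1 z) = 0 by exact: df_df.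
have dx' : d0 x' = 0 by rewrite /d0 /x' dfD -/(d0 _) dx add0r; exact: dd.
have dy' : d0 y' = 0 by rewrite /d0 /y' dfD -/(d0 _) dy add0r; exact: dd.
elim: w => [|c w IH]; first by rewrite /dm1 /= df0 addr0.
case: w IH => [_|c' w IH]; first by case: c.
set w' := c' :: w in IH *.
have dn : d0 (nested_br x' y' w') = 0 by exact: cycle_nested.
change (br (add0r 0) (if c then x' else y') (nested_br x' y' w')
  = br (add0r 0) (if c then x else y) (nested_br x y w')
    + dm1 (br (add0r (-1)) (if c then x else y) (nested_prim w')
           + br (addr0 (-1)) (if c then u else v) (nested_br x' y' w'))).
have -> : (if c then x' else y') = (if c then x else y) + dm1 (if c then u else v).
  by case: c.
rewrite /dm1 dfD.
rewrite (df_leibniz (add0r (-1)) (erefl : 0 + 1 = 1 :> int)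
  (erefl : -1 + 1 = 0 :> int) erefl (erefl : 1 + -1 = 0 :> int) (add0r 0)).
rewrite (df_leibniz (addr0 (-1)) (erefl : -1 + 1 = 0 :> int)
  (erefl : 0 + 1 = 1 :> int) erefl (add0r 0) (erefl : -1 + 1 = 0 :> int)).
rewrite -!/(d0 _) dn br0r scaler0 addr0.
have -> : d0 (if c then x else y) = 0 by case: c.
rewrite br0l add0r expr0z scale1r brDl {1}IH brDr addrA.
by rewrite -/(dm1 _) -/(dm1 _).
Qed.

Lemma lcs_prim i w : lcs (size w).-1 (pr i (-1) (nested_prim w)).
Proof.
elim: w => [|c w IH]; first exact: Lcs0.
case: w IH => [_|c' w IH]; first exact: Lcs0.
rewrite [X in lcs _ X](_ : _ = br (add0r (-1)) (pr i 0 (if c then x else y))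
    (pr i (-1) (nested_prim (c' :: w)))
  + br (addr0 (-1)) (pr i (-1) (if c then u else v))
    (pr i 0 (nested_br x' y' (c' :: w)))); last by rewrite mf_D !mf_br.
apply: lcsD; first exact: LcsBr.
apply: LcsBr; exact: (@lcs_nested F p i x' y' (c' :: w)).
Qed.

(** Boundaries are an ideal among cycles, so moving the factors by boundaries
    moves the product by a boundary; the primitive is an infinite sum, which
    converges because the primitives of long brackets lie deep in the lower
    central series. *)
Lemma bch_boundary : exists w, bch x' y' = bch x y + dm1 w.
Proof.
pose t n : p (-1) := (n.+1)%:R^-1 *:
    \sum_(w : n.+1.-tuple bool) bch_coef F w *: nested_prim w.
have tc : pconv t.
  apply: pconv_lcs => i k; rewrite /t mf_Z linear_sum; apply: lcsZ.
  apply: lcs_sum => w _; rewrite /= mf_Z; apply: lcsZ.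
  by have := lcs_prim i w; rewrite size_tuple.
have dtc : pconv (fun n => dm1 (t n)).
  by move=> i; have [N HN] := tc i; exists N => k le; rewrite mf_df HN // df0.
exists (psum t); rewrite /dm1 -psum_df // /bch -psumD //; last exact: pconv_bch.
congr psum; apply/funext => n; rewrite /t dfZ df_sum -scalerDr -big_split.
congr (_ *: _); apply: eq_bigr => w _ /=.
by rewrite dfZ nested_primP scalerDr.
Qed.
End Boundary.
End Cycles.

(** * Quotient sets and the group exp(H^0) *)

Section Classes.
Variables (T : Type) (R : T -> T -> Prop).

Lemma cls_surj (C : classes R) : exists x, C = cls R x.
Proof. by case: C => A [x Ax]; exists x; exact: eq_exist. Qed.

Definition crepr (C : classes R) : T := sval (cid (cls_surj C)).
Lemma creprK C : cls R (crepr C) = C.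
Proof. by rewrite /crepr; case: cid => x /= ->. Qed.

Hypotheses (Rrefl : forall x, R x x) (Rsym : forall x y, R x y -> R y x)
  (Rtrans : forall x y z, R x y -> R y z -> R x z).

Lemma clsP x y : cls R x = cls R y <-> R x y.
Proof.
split=> [/(congr1 (fun C : classes R => sval C y)) /= -> //|xy].
apply: eq_exist; apply/funext => z; apply/propext; split=> H.
  exact: Rtrans (Rsym xy) H.
exact: Rtrans H.
Qed.
End Classes.

Section Equivalences.
Variables (F : fieldType) (charF0 : [pchar F] =i pred0).

Lemma gauge_equiv_refl (g : pronil F) (x : MC g) : gauge_equiv x x.
Proof. by exists 0; rewrite gauge0. Qed.

Lemma gauge_equiv_sym (g : pronil F) (x y : MC g) : gauge_equiv x y -> gauge_equiv y x.
Proof. by move=> [a ya]; exists (- a); rewrite ya gaugeNK. Qed.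

Lemma gauge_equiv_trans (g : pronil F) (x y z : MC g) :
  gauge_equiv x y -> gauge_equiv y z -> gauge_equiv x z.
Proof. by move=> [a ya] [b zb]; exists (bch b a); rewrite gauge_bch // -ya. Qed.

Lemma mclsP (g : pronil F) (x y : MC g) : mcls x = mcls y <-> gauge_equiv x y.
Proof.
apply: clsP; [exact: gauge_equiv_refl|exact: gauge_equiv_sym|exact: gauge_equiv_trans].
Qed.

Lemma cohom0_refl (L : dgla F) (x : cyc0 L) : cohom0 x x.
Proof. by exists 0; rewrite df0 addr0. Qed.

Lemma cohom0_sym (L : dgla F) (x y : cyc0 L) : cohom0 x y -> cohom0 y x.
Proof. by move=> [u xy]; exists (- u); rewrite xy -scaleN1r dfZ scaleN1r addrK. Qed.

Lemma cohom0_trans (L : dgla F) (x y z : cyc0 L) : cohom0 x y -> cohom0 y z -> cohom0 x z.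
Proof. by move=> [u xy] [v yz]; exists (u + v); rewrite yz xy dfD addrA. Qed.

Lemma hclsP (L : dgla F) (x y : cyc0 L) : hcls x = hcls y <-> cohom0 x y.
Proof. apply: clsP; [exact: cohom0_refl|exact: cohom0_sym|exact: cohom0_trans]. Qed.

Lemma map_gauge_equiv (g h : pronil F) (f : pdgmap g h) (x y : MC g) :
  gauge_equiv x y -> gauge_equiv (mc_map f x) (mc_map f y).
Proof. by move=> [a ya]; exists (f 0 a); rewrite /= ya map_gauge. Qed.

Lemma MCmod_map_cls (g h : pronil F) (f : pdgmap g h) (x : MC g) :
  MCmod_map f (mcls x) = mcls (mc_map f x).
Proof.
rewrite /MCmod_map /classes_map; apply/mclsP/map_gauge_equiv.
case: cid => /= y yx; have : mcls x = mcls y by exact: eq_exist.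
by move/mclsP; exact: gauge_equiv_sym.
Qed.
End Equivalences.

HB.instance Definition _ (F : fieldType) (L : dgla F) := gen_eqMixin (H0 L).
HB.instance Definition _ (F : fieldType) (L : dgla F) := gen_choiceMixin (H0 L).

Section ExpH0.
Variables (F : fieldType) (charF0 : [pchar F] =i pred0) (p : pronil F).
Let Z := cyc0 p.

Lemma bch_cyc (x y : Z) : df (erefl : 0 + 1 = 1 :> int) (bch (val x) (val y)) == 0.
Proof. by apply/eqP/cycle_bch; [exact: (eqP (valP x))|exact: (eqP (valP y))]. Qed.

(** The product of degree 0 cycles. *)
Definition cbch (x y : Z) : Z := exist _ (bch (val x) (val y)) (bch_cyc x y).

Lemma zero_cyc : df (erefl : 0 + 1 = 1 :> int) (0 : p 0) == 0.
Proof. by rewrite df0. Qed.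
Definition czero : Z := exist _ 0 zero_cyc.

Lemma opp_cyc (x : Z) : df (erefl : 0 + 1 = 1 :> int) (- val x) == 0.
Proof. by rewrite -scaleN1r dfZ (eqP (valP x)) scaler0. Qed.
Definition copp (x : Z) : Z := exist _ (- val x) (opp_cyc x).

Lemma cohom0_bch (x x' y y' : Z) : cohom0 x x' -> cohom0 y y' ->
  cohom0 (cbch x y) (cbch x' y').
Proof.
move=> [u xx'] [v yy'].
have [w E] := bch_boundary u v (eqP (valP x)) (eqP (valP y)).
by exists w; rewrite /= xx' yy'.
Qed.

Definition hmul (a b : H0 p) : H0 p := hcls (cbch (crepr a) (crepr b)).
Definition hinv (a : H0 p) : H0 p := hcls (copp (crepr a)).

Lemma hmulE x y : hmul (hcls x) (hcls y) = hcls (cbch x y).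
Proof.
apply/hclsP/cohom0_bch; apply/hclsP; exact: creprK.
Qed.

Lemma hmulA : associative hmul.
Proof.
move=> a b c; rewrite -[a]creprK -[b]creprK -[c]creprK -!/(hcls _) !hmulE.
by congr hcls; apply: val_inj; rewrite /= bchA.
Qed.

Lemma hmul0 : left_id (hcls czero) hmul.
Proof.
move=> a; rewrite -[a]creprK -!/(hcls _) hmulE; congr hcls; apply: val_inj.
exact: bch0x.
Qed.

Lemma hmulr0 : right_id (hcls czero) hmul.
Proof.
move=> a; rewrite -[a]creprK -!/(hcls _) hmulE; congr hcls; apply: val_inj.
exact: bchx0.
Qed.

Lemma hmulN : left_inverse (hcls czero) hinv hmul.
Proof.
move=> a; rewrite -[X in hmul _ X]creprK /hinv -!/(hcls _) hmulE.
congr hcls; apply: val_inj; exact: bchNx.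
Qed.

Lemma hmulNr : right_inverse (hcls czero) hinv hmul.
Proof.
move=> a; rewrite -[X in hmul X _]creprK /hinv -!/(hcls _) hmulE.
congr hcls; apply: val_inj; exact: bchxN.
Qed.

Definition expH0 : groupType :=
  HB.pack (H0 p) (isGroup.Build (H0 p) hmulA hmul0 hmulr0 hmulN hmulNr).

Lemma expH0_group : is_expH0 (id : H0 p -> expH0).
Proof.
split; first by exists id.
by move=> x y; exists (cbch x y) => //; exact: hmulE.
Qed.
End ExpH0.

(** * Twisting by a Maurer-Cartan element *)

Section TwistFacts.
Variables (F : fieldType) (charF0 : [pchar F] =i pred0) (g : pronil F) (xi : MC g).

Lemma curv_shift (eta : g 1) :
  mc_curv (eta + val xi) = @mc_curv F (twist charF0 xi) eta + mc_curv (val xi).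
Proof.
(* The cross terms of half the square of eta + xi are half [xi, eta] twice. *)
pose e := erefl : 1 + 1 = 2 :> int; set x : g 1 := val xi.
have bC : br e eta x = br e x eta.
  by rewrite (br_anti _ e) mul1r expr1z scaleN1r opprK.
have half : 2^-1 *: br e x eta + 2^-1 *: br e x eta = br e x eta.
  by rewrite -mulr2n -scaler_nat scalerA mulfV ?(two_unit charF0) // scale1r.
change (df e (eta + x) + 2^-1 *: br e (eta + x) (eta + x)
  = (df e eta + br (deg_swap e) x eta + 2^-1 *: br e eta eta)
    + (df e x + 2^-1 *: br e x x)).
rewrite (br_irr (deg_swap e) e) dfD !brDl !brDr bC !scalerDr.
by rewrite -[in RHS]half [LHS](AC (2*(2*2)) ((1*(4*5)*3)*(2*6))).
Qed.

Lemma ad0_anti (y : g 0) (m : g 1) : br (deg_swap (erefl : 0 + 1 = 1 :> int)) m y = - ad0 y m.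
Proof. by rewrite (br_anti _ (add0r 1)) mulr0 expr0z scale1r. Qed.

(** The gauge action of the twist is the gauge action transported along the
    translation by xi. *)
Lemma gauge_twist (y : g 0) (eta : g 1) :
  @gauge F (ptwist charF0 xi) y eta + val xi = gauge y (eta + val xi).
Proof.
rewrite /gauge [RHS]addrAC; congr (_ + _ + _).
change (psum (fun n : nat => n.+1`!%:R^-1 *: iter n (ad0 y)
    (ad0 y eta - (df (erefl : 0 + 1 = 1 :> int) y
      + br (deg_swap (erefl : 0 + 1 = 1 :> int)) (val xi) y)) : g 1)
  = psum (fun n : nat => n.+1`!%:R^-1 *: iter n (ad0 y)
    (ad0 y (eta + val xi) - df (erefl : 0 + 1 = 1 :> int) y))).
congr psum; apply/funext => n; congr (_ *: iter n _ _).
by rewrite ad0_anti /ad0 brDr opprD opprK addrAC addrA.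
Qed.

Lemma twist_cycle_fix (y : g 0) :
  @df F (ptwist charF0 xi) _ _ (erefl : 0 + 1 = 1 :> int) y = 0
  <-> gauge y (val xi) = val xi.
Proof.
rewrite -gauge_fix //.
change ((df (erefl : 0 + 1 = 1 :> int) y
      + br (deg_swap (erefl : 0 + 1 = 1 :> int)) (val xi) y) = 0
   <-> ad0 y (val xi) - df (erefl : 0 + 1 = 1 :> int) y = 0).
rewrite ad0_anti; split=> /eqP; rewrite subr_eq0 => /eqP ->; exact: subrr.
Qed.

Lemma twist_boundary_fix (v : g (-1)) :
  @gauge F g (@df F (ptwist charF0 xi) _ _ (erefl : -1 + 1 = 0 :> int) v) (val xi) = val xi.
Proof. by apply/twist_cycle_fix; exact: df_df. Qed.
End TwistFacts.

(** * The fibre over a Maurer-Cartan element *)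

Section Main.
Variables (F : fieldType) (charF0 : [pchar F] =i pred0).
Variables (g h : pronil F) (f : pdgmap g h) (fsurj : psurjective f).
Variables (xi0 : MC h) (xi : MC g) (fxi : f 1 (val xi) = val xi0).
Let k : pronil F := twker charF0 fxi.
Let hxi0 : pronil F := ptwist charF0 xi0.
Let tw := twist_pdgmap charF0 fxi.

Definition fibre_pt (eta : MC k) : MC g := twker_shift eta.

Lemma twker_mem n (x : k n) : f n (twker_val x) = 0.
Proof. exact: (eqP (valP x)). Qed.

Definition twker_lift n (x : g n) (fx : f n x = 0) : k n :=
  exist _ x (introT eqP fx).

Lemma twker_val_inj n : injective (@twker_val F charF0 g h f xi xi0 fxi n).
Proof. by move=> x y; exact: val_inj. Qed.

Lemma twker_incl_cont n (i : idx (psys (ptwist charF0 xi))) : exists j : idx (psys k),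
  forall x : k n, pr j n x = 0 -> pr i n (pker_incl tw n x) = 0.
Proof. by exists i => x /(congr1 val). Qed.

(** The inclusion of the kernel as a continuous map, so that the naturality of
    the gauge action applies to it. *)
Definition twker_incl : pdgmap k (ptwist charF0 xi) := @PMap F k (ptwist charF0 xi)
  (pker_incl tw) twker_incl_cont.

Lemma fibre_pt_gauge (a : k 0) (eta : k 1) :
  twker_val (gauge a eta) + val xi = gauge (twker_val a) (twker_val eta + val xi).
Proof. by rewrite -(gauge_twist charF0 xi) -[twker_val _]/(twker_incl 1 _) map_gauge. Qed.

Lemma map_fibre_pt (eta : MC k) : f 1 (val (fibre_pt eta)) = val xi0.
Proof. by rewrite [f 1 _]mf_D fxi [X in X + _](twker_mem (val eta)) add0r. Qed.

Lemma fibre_pt_surj (mu : MC g) : f 1 (val mu) = val xi0 -> exists eta, fibre_pt eta = mu.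
Proof.
move=> fmu; have fd : f 1 (val mu - val xi) = 0 by rewrite linearB /= fmu fxi subrr.
have mc : mc_curv (twker_lift fd) == 0.
  apply/eqP/twker_val_inj; rewrite [RHS]linear0.
  have := curv_shift charF0 xi (val mu - val xi).
  rewrite subrK (eqP (valP mu)) (eqP (valP xi)) addr0 => E; exact: esym E.
exists (exist _ (twker_lift fd) mc); apply: val_inj.
exact: subrK.
Qed.

(** After translation by xi, the gauge action of the kernel is the gauge action
    of g restricted to the elements that f kills. *)
Lemma gauge_equiv_fibre_pt (eta eta' : MC k) : gauge_equiv eta eta' <->
  exists2 a, f 0 a = 0 & val (fibre_pt eta') = gauge a (val (fibre_pt eta)).
Proof.
split=> [[a E]|[a fa E]].
  exists (twker_val a); first exact: twker_mem.
  by rewrite -[RHS]fibre_pt_gauge -E.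
exists (twker_lift fa); apply: twker_val_inj; apply: (addIr (val xi)).
by rewrite fibre_pt_gauge; exact: E.
Qed.

(** The action before passing to classes: eta' is one of the possible values of
    y0 on eta, depending on the lift y. *)
Definition lift_acts (y0 : cyc0 hxi0) (eta eta' : MC k) : Prop :=
  exists2 y, f 0 y = val y0 & val (fibre_pt eta') = gauge y (val (fibre_pt eta)).

Lemma lift_acts_lift (y0 : cyc0 hxi0) y (eta : MC k) : f 0 y = val y0 ->
  exists eta', val (fibre_pt eta') = gauge y (val (fibre_pt eta)).
Proof.
move=> fy; have := @fibre_pt_surj (mc_gauge charF0 y (fibre_pt eta)).
case=> [|eta' E]; last by exists eta'; rewrite E.
rewrite [LHS]map_gauge map_fibre_pt fy; apply/(twist_cycle_fix charF0).
exact: (eqP (valP y0)).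
Qed.

Lemma lift_acts_ex y0 eta : exists eta', lift_acts y0 eta eta'.
Proof.
have [y fy] := fsurj (val y0 : h 0).
by have [eta' E] := lift_acts_lift eta fy; exists eta'; exists y.
Qed.

(** The class of eta' depends only on the class of y0 and on that of eta.  Let
    mu be the point eta1' + xi of the fibre.  The point eta2' + xi is the
    transform of mu by some c whose image in h is a boundary d w for the
    differential twisted by xi0.  Lift w to W.  The element b = d^mu W fixes mu
    and has the same image as c, so c may be replaced by the product of c and
    -b, which f kills. *)
Lemma lift_acts_equiv (y0 y0' : cyc0 hxi0) eta1 eta2 eta1' eta2' :
  cohom0 y0 y0' -> gauge_equiv eta1 eta2 ->
  lift_acts y0 eta1 eta1' -> lift_acts y0' eta2 eta2' -> gauge_equiv eta1' eta2'.
Proof.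
move=> [u y0E] /gauge_equiv_fibre_pt[a fa E2] [y fy E1'] [y' fy' E2']; apply/gauge_equiv_fibre_pt.
have E1 : val (fibre_pt eta1) = gauge (- y) (val (fibre_pt eta1')) by rewrite E1' gaugeNK.
pose c := bch (bch y' a) (- y).
have Ec : val (fibre_pt eta2') = gauge c (val (fibre_pt eta1')).
  by rewrite E2' E2 E1 /c !gauge_bch.
have [w fc] : exists w : hxi0 (-1), f 0 c = df (erefl : -1 + 1 = 0 :> int) w.
  (* The image of c is the product of y0 + d u and -y0; that of y0 and -y0 is 0. *)
  have [w Ew] := bch_boundary u 0 (eqP (valP y0)) (eqP (opp_cyc y0)).
  exists w; rewrite /c !map_bch fa bchx0 // fy' y0E linearN /= fy.
  rewrite -[RHS]add0r -(bchxN charF0 (val y0 : hxi0 0)).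
  by rewrite -Ew df0 addr0.
have [W fW] := fsurj (w : h (-1)).
pose b : g 0 := @df F (ptwist charF0 (fibre_pt eta1')) _ _ (erefl : -1 + 1 = 0 :> int) W.
have fb : f 0 b = f 0 c.
  by rewrite fc [LHS]mf_D mf_df mf_br fW map_fibre_pt.
(* b has the same image as c, so this element is in the kernel of f. *)
exists (bch c (- b)).
  by rewrite map_bch linearN /= fb bchxN.
rewrite gauge_bch // Ec; congr gauge.
by rewrite -[in RHS](twist_boundary_fix charF0 (fibre_pt eta1') W) gaugeNK.
Qed.

(** Defined by arbitrary choices of representatives and of a lift; by
    [lift_acts_equiv] the result does not depend on them. *)
Definition class_act (a : H0 hxi0) (C : MCmod k) : MCmod k :=
  mcls (sval (cid (lift_acts_ex (crepr a) (crepr C)))).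

Lemma class_actE y0 eta eta' : lift_acts y0 eta eta' -> class_act (hcls y0) (mcls eta) = mcls eta'.
Proof.
move=> H; apply/mclsP => //; rewrite /class_act.
case: cid => eta'' /= H'; apply: lift_acts_equiv H' H.
  by apply/hclsP; exact: creprK.
by apply/(mclsP charF0); exact: creprK.
Qed.

Lemma class_act_action : is_group_action (G := expH0 charF0 hxi0) class_act.
Proof.
split=> [C|a b C].
  rewrite -[C]creprK; apply: (@class_actE (czero hxi0)).
  by exists 0; rewrite ?mf_0 // gauge0.
rewrite -[C]creprK -[a]creprK -[b]creprK -!/(hcls _) -!/(mcls _).
have [eta1 H1] := lift_acts_ex (crepr b) (crepr C).
have [eta2 H2] := lift_acts_ex (crepr a) eta1.
rewrite (class_actE H1) (class_actE H2) [X in class_act X _]hmulE; apply: class_actE.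
case: H1 => y fy E1; case: H2 => z fz E2.
by exists (bch z y); rewrite ?map_bch ?fy ?fz // gauge_bch // -E1.
Qed.

Let orb := orbit_rel class_act.

Lemma orb_refl C : orb C C.
Proof. by exists (hcls (czero hxi0)); rewrite (proj1 class_act_action). Qed.
Lemma orb_sym C D : orb C D -> orb D C.
Proof.
move=> [a ->]; exists (hinv a).
by rewrite -(proj2 class_act_action) [(_ * _)%g](hmulN charF0) (proj1 class_act_action).
Qed.
Lemma orb_trans C D E : orb C D -> orb D E -> orb C E.
Proof.
move=> [a ->] [b ->]; exists (hmul b a); exact/esym/(proj2 class_act_action).
Qed.

Lemma orbP C D : cls orb C = cls orb D <-> orb C D.
Proof. apply: clsP; [exact: orb_refl|exact: orb_sym|exact: orb_trans]. Qed.

Lemma orb_lift_acts eta eta' : orb (mcls eta) (mcls eta') <-> exists y0, lift_acts y0 eta eta'.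
Proof.
split=> [[a]|[y0 H]]; last by exists (hcls y0); rewrite (class_actE H).
rewrite -[a]creprK -/(hcls _).
have [eta1 H] := lift_acts_ex (crepr a) eta.
rewrite (class_actE H) => /(mclsP charF0) /gauge_equiv_sym - /(_ charF0) /gauge_equiv_fibre_pt[b fb E].
exists (crepr a); case: H => y fy E1; exists (bch b y).
  by rewrite map_bch fb fy bch0x.
by rewrite gauge_bch // -E1.
Qed.

(** If y carries a point of the fibre to another one, then f y fixes xi0, hence
    is a cycle for the twisted differential. *)
Lemma orb_gauge eta eta' :
  orb (mcls eta) (mcls eta') <-> gauge_equiv (fibre_pt eta) (fibre_pt eta').
Proof.
rewrite orb_lift_acts; split=> [[y0 [y _ E]]|[y E]]; first by exists y.
have cyc : @df F hxi0 _ _ (erefl : 0 + 1 = 1 :> int) (f 0 y) == 0.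
  by apply/eqP/twist_cycle_fix => //; rewrite -(map_fibre_pt eta) -map_gauge -E !map_fibre_pt.
by exists (exist _ (f 0 y) cyc); exists y.
Qed.

Lemma fibre_cls eta : MCmod_map f (mcls (fibre_pt eta)) = mcls xi0.
Proof. by rewrite MCmod_map_cls //; congr mcls; apply: val_inj; exact: map_fibre_pt. Qed.

(** Lift to g a gauge transformation that takes f mu to xi0. *)
Lemma fibre_surj C : MCmod_map f C = mcls xi0 -> exists eta, C = mcls (fibre_pt eta).
Proof.
rewrite -[C]creprK -/(mcls _) MCmod_map_cls // => /(mclsP charF0)[z0 E].
have [z fz] := fsurj z0.
have [|eta Eeta] := @fibre_pt_surj (mc_gauge charF0 z (crepr C)).
  by rewrite [LHS]map_gauge fz E.
by exists eta; apply/(mclsP charF0); exists z; rewrite Eeta.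
Qed.

Definition orbit_to_fibre (O : classes orb) : {C : MCmod g | MCmod_map f C = mcls xi0} :=
  exist _ _ (fibre_cls (crepr (crepr O))).

Lemma orbit_to_fibreE eta : sval (orbit_to_fibre (cls orb (mcls eta))) = mcls (fibre_pt eta).
Proof.
apply/(mclsP charF0)/orb_gauge; apply/orbP; rewrite [mcls _]creprK.
exact: creprK.
Qed.

Lemma orb_surj (O : classes orb) : exists eta, O = cls orb (mcls eta).
Proof.
have [C ->] := cls_surj O; have [eta ->] := cls_surj C.
by exists eta.
Qed.

Lemma orbit_to_fibre_bij : bijective orbit_to_fibre.
Proof.
have inj : injective orbit_to_fibre.
  move=> O O'; have [eta ->] := orb_surj O; have [eta' ->] := orb_surj O'.
  move=> E; apply/orbP/orb_gauge/(mclsP charF0).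
  exact: (etrans (esym (orbit_to_fibreE eta)) (etrans (congr1 sval E) (orbit_to_fibreE eta'))).
have surj C : exists O, orbit_to_fibre O = C.
  case: C => C HC; have [eta E] := fibre_surj HC.
  by exists (cls orb (mcls eta)); apply: eq_exist; rewrite [LHS]orbit_to_fibreE.
exists (fun C => sval (cid (surj C))) => [O|C]; last by case: cid.
by apply: inj; case: cid.
Qed.

End Main.

Theorem theoremA13 (F : fieldType) (charF0 : [pchar F] =i pred0)
    (g h : pronil F) (f : pdgmap g h) (fsurj : psurjective f)
    (xi0 : MC h) (xi : MC g) (fxi : f 1 (val xi) = val xi0) :
  let k : pronil F := twker charF0 fxi in
  let hxi0 : pronil F := ptwist charF0 xi0 in
  exists (G : groupType) (e : H0 hxi0 -> G) (act : G -> MCmod k -> MCmod k),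
    [/\ is_expH0 e,
        is_group_action act,
        (forall (y0 : cyc0 hxi0) (y : g 0) (eta : MC k), f 0 y = val y0 ->
           exists2 eta' : MC k,
             twker_val (val eta')
               = gauge y (twker_val (val eta) + val xi) - val xi
             & act (e (hcls y0)) (mcls eta) = mcls eta')
      & exists phi : classes (orbit_rel act) ->
                     {C : MCmod g | MCmod_map f C = mcls xi0},
          bijective phi /\
          (forall eta : MC k,
             sval (phi (cls (orbit_rel act) (mcls eta)))
               = mcls (twker_shift eta))].
Proof.
move=> k hxi0.
exists (expH0 charF0 hxi0), id, (class_act (charF0 := charF0) fsurj (fxi := fxi)); split.
- exact: expH0_group.
- exact: class_act_action.
- move=> y0 y eta fy; have [eta' E] := lift_acts_lift eta fy.
  exists eta'; last by apply: class_actE; exists y.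
  by rewrite -[X in X - _]E addrK.
- exists (@orbit_to_fibre F charF0 g h f fsurj xi0 xi fxi); split; first exact: orbit_to_fibre_bij.
  exact: orbit_to_fibreE.
Qed.
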